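(* Let $k\ge2$ and let $\mu$ be a probability measure on $\mathbb{R}$ satisfying the standing assumptions below and $\int_{\mathbb{R}}|x|\,d\mu<+\infty$. Let $\nu$ be a solution to $\min_{\lambda\in\mathcal{P}_k(\mathbb{R})}W_1(\mu,\lambda)$ with support points $y_1\le y_2\le\dots\le y_k$. Then $\vec v_\mu=(F_\mu(y_1),\dots,F_\mu(y_k))\in(0,1)^k$ is an optimal percentile vector, and $y_1,\dots,y_k$ satisfy the system \[ \begin{cases} 2F_\mu(y_1)=F_\mu\big(\tfrac{y_1+y_2}{2}\big),\\[2pt] 2\Big(F_\mu(y_j)-F_\mu\big(\tfrac{y_{j-1}+y_j}{2}\big)\Big)=F_\mu\big(\tfrac{y_j+y_{j+1}}{2}\big)-F_\mu\big(\tfrac{y_{j-1}+y_j}{2}\big),\quad j=2,\dots,k-1,\\[2pt] 2\Big(F_\mu(y_k)-F_\mu\big(\tfrac{y_{k-1}+y_k}{2}\big)\Big)=1-F_\mu\big(\tfrac{y_{k-1}+y_k}{2}\big). \end{cases} \]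
   Context: For $\vec x\in\mathbb{R}^n$, $\vec y\in\mathbb{R}^k$: $SC(\vec x,\vec y)=\frac1n\sum_i\min_j|x_i-y_j|$, $SC_{opt}(\vec x)=\min_{\vec y}SC(\vec x,\vec y)$. A percentile vector is $\vec v$ with $0\le v_1\le\dots\le v_k\le1$; $\mathcal{PM}_{\vec v}$ sorts the reports $x_{(1)}\le\dots\le x_{(n)}$ and places facility $j$ at $x_{(\lfloor(n-1)v_j\rfloor+1)}$. With $\vec X_n$ i.i.d. of law $\mu$, $B^{(n)}_{ar}(f)=\mathbb{E}[SC_f(\vec X_n)]/\mathbb{E}[SC_{opt}(\vec X_n)]$; a percentile vector is optimal for $\mu$ if $\lim_n B^{(n)}_{ar}$ of its mechanism equals $1$. $\mathcal{P}_k(\mathbb{R})$: probability measures $\sum_{j=1}^k\nu_j\delta_{x_j}$. $W_1$: 1-Wasserstein distance. $F_\mu$: c.d.f. of $\mu$. Standing assumptions on $\mu$: absolutely continuous with density $\rho_\mu$; support an interval on whose interior $\rho_\mu>0$; $\rho_\mu$ differentiable on the support. *)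

(* Defs.v *)
From HB Require Import structures.
From mathcomp Require Import all_boot all_order all_algebra.
From mathcomp Require Import all_classical all_reals all_analysis.
Set Implicit Arguments. Unset Strict Implicit. Unset Printing Implicit Defensive.
Import Order.TTheory GRing.Theory Num.Theory numFieldNormedType.Exports.
Local Open Scope classical_set_scope.
Local Open Scope ring_scope.

Section facility.
Context {R : realType}.

Definition cdfm (mu : set R -> \bar R) (r : R) : R := fine (mu [set` `]-oo, r]]).

Definition discr (k : nat) (w x : nat -> R) : set R -> \bar R :=
  fun A => (\sum_(j < k) (w j)%:E * \d_(x j) A)%E.

Definition Pk_weights (k : nat) (w : nat -> R) : Prop :=
  (forall j, (j < k)%N -> 0 <= w j) /\ \sum_(j < k) w j = 1.

Definition is_coupling (mu nu : set R -> \bar R)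
  (pi : probability (R * R)%type R) : Prop :=
  (forall A : set R, measurable A -> pi (A `*` setT) = mu A) /\
  (forall B : set R, measurable B -> pi (setT `*` B) = nu B).

Definition W1 (mu nu : set R -> \bar R) : \bar R :=
  ereal_inf [set (\int[pi]_z (`|z.1 - z.2|)%:E)%E | pi in is_coupling mu nu].

Definition mindist (k : nat) (x : R) (y : nat -> R) : \bar R :=
  \big[Order.min/+oo%E]_(j < k) (`|x - y j|)%:E.

Definition SC (k : nat) (s : seq R) (y : nat -> R) : \bar R :=
  (((size s)%:R)^-1%:E * \sum_(x <- s) mindist k x y)%E.

Definition SCopt (k : nat) (s : seq R) : \bar R :=
  ereal_inf [set SC k s y | y in [set: nat -> R]].

Definition percentile_vector (k : nat) (v : nat -> R) : Prop :=
  (forall j, (j < k)%N -> 0 <= v j <= 1) /\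
  (forall i j, (i <= j)%N -> (j < k)%N -> v i <= v j).

(** percentile mechanism: facility j at the order statistic
    x_(floor((n-1) v_j) + 1) (1-based), i.e. index floor((n-1) v_j) (0-based)
    of the sorted reports *)
Definition PM (v : nat -> R) (s : seq R) : nat -> R :=
  fun j => nth 0 (sort <=%R s) (Num.truncn ((size s).-1%:R * v j)).

(** E[g(X_1,...,X_n)] for X_1..X_n i.i.d. of law mu, as an iterated
    integral (Tonelli: equals the integral against the product measure
    mu^n for nonnegative measurable g) *)
Fixpoint iter_int (mu : probability R R) (n : nat) (g : seq R -> \bar R)
  : \bar R :=
  match n with
  | 0 => g [::]
  | n'.+1 => (\int[mu]_x iter_int mu n' (fun s => g (x :: s)))%E
  end.

Definition Bar (k : nat) (mu : probability R R) (f : seq R -> nat -> R)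
  (n : nat) : R :=
  fine (iter_int mu n (fun s => SC k s (f s))) /
  fine (iter_int mu n (SCopt k)).

Definition optimal_percentile_vector (k : nat) (mu : probability R R)
  (v : nat -> R) : Prop :=
  percentile_vector k v /\ (Bar k mu (PM v)) @ \oo --> (1 : R).

(** standing assumptions: mu has a density rho w.r.t. Lebesgue measure,
    the support of mu is an interval with endpoints a < b (possibly
    infinite), rho > 0 in its interior, rho = 0 outside, and rho is
    differentiable on the support (one-sided at finite endpoints) *)
Definition standing_assumptions (mu : probability R R) : Prop :=
  exists (rho : R -> R) (a b : \bar R),
    (a < b)%E /\
    measurable_fun setT rho /\
    (forall x, 0 <= rho x) /\
    (forall A : set R, measurable A ->
       mu A = (\int[lebesgue_measure]_(x in A) (rho x)%:E)%E) /\
    (forall x : R, (x%:E < a)%E \/ (b < x%:E)%E -> rho x = 0) /\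
    (forall x : R, (a < x%:E)%E -> (x%:E < b)%E -> 0 < rho x) /\
    (forall x : R, (a < x%:E)%E -> (x%:E < b)%E -> derivable rho x 1) /\
    (forall x : R, a = x%:E ->
       cvg ((fun h => h^-1 * (rho (x + h) - rho x)) @ 0^'+)) /\
    (forall x : R, b = x%:E ->
       cvg ((fun h => h^-1 * (rho (x + h) - rho x)) @ 0^'-)).

End facility.

(* Main.v *)
Require Import Defs.
From mathcomp Require Import all_boot all_order all_algebra.
From mathcomp Require Import all_classical all_reals all_analysis.
From mathcomp Require Import measurable_realfun ring lra.
Set Implicit Arguments. Unset Strict Implicit. Unset Printing Implicit Defensive.
Import Order.TTheory GRing.Theory Num.Theory numFieldNormedType.Exports.
Local Open Scope classical_set_scope.
Local Open Scope ring_scope.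

(** Any coupling of [mu] with [sum_j w_j delta_{y_j}] costs at least the mean
    distance [D(y)] to the nearest [y_j], and the nearest-point map attains it,
    so the support of an optimal [nu] minimises [D]. Moving one point [y_j] by
    a small [h] in either direction turns minimality into the system for [F];
    a cell of null mass is impossible because its point could be sent to
    strictly lower the cost elsewhere.

    For the limit, [E SC_opt <= E SC_PM] always, so two bounds suffice.
    Upper bound: by Chebyshev the percentiles are close to the [y_j] with high
    probability, and otherwise the cost is at most a constant times the sample
    mean of [|x|], which is uniformly integrable. Lower bound: approximate the
    identity in L^1 by a finitely valued [phi]; the cost is 1-Lipschitz in the
    observation, so the empirical cost of any facilities is at least [D] minus
    the approximation errors and the deviations of finitely many empirical
    frequencies, uniformly in the facilities. All error terms are sums over the
    sample or squares of such sums, whose iterated integrals are explicit, so no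
    measurability of [SC_opt] or of the percentiles is needed. *)

(** * Lower integrals *)

Section lower_integral.
Context {d : measure_display} {T : measurableType d} {R : realType}.
Variable mu : {measure set T -> \bar R}.
Local Open Scope ereal_scope.
Import HBNNSimple.

(* The integral of a nonnegative function is the supremum over the simple
   functions below it, so it is monotone even on non-measurable functions. *)
Lemma ge0_le_lower_integral (f g : T -> \bar R) :
  (forall x, 0 <= f x) -> (forall x, f x <= g x) ->
  \int[mu]_x f x <= \int[mu]_x g x.
Proof.
move=> f0 fg; rewrite !ge0_integralTE//; last by move=> x; exact: le_trans (fg x).
by apply: ereal_sup_le => _ [h /= hf <-]; exists h => // x; exact: le_trans (fg x).
Qed.

(** Here [f] may be non-measurable: a simple [h] below [f + g] yields the measurable
    [u = max(h - g, 0)], which lies below [f] and satisfies [h <= u + g], and additivity is applied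
    to [u] and [g] only. *)
Lemma lower_integralD_le (f g : T -> \bar R) :
  (forall x, 0 <= f x) -> (forall x, 0 <= g x) -> measurable_fun setT g ->
  \int[mu]_x (f x + g x) <= \int[mu]_x f x + \int[mu]_x g x.
Proof.
move=> f0 g0 mg; rewrite [leLHS]ge0_integralTE//; last by move=> x; exact: adde_ge0.
apply: ge_ereal_sup => _ [h /= hfg <-]; rewrite -integralT_nnsfun.
pose u x := maxe ((h x)%:E - g x) 0.
have u0 x : 0 <= u x by rewrite /u le_max lexx orbT.
have mu_ : measurable_fun setT u.
  apply: measurable_maxe => //; apply: emeasurable_funB => //.
  exact/measurable_EFinP.
have uf x : u x <= f x.
  rewrite /u ge_max f0 andbT; move: (g0 x) (hfg x).
  by case: (g x) => [r|//|//] _ ?; rewrite ?leNye// leeBlDr.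
apply: le_trans (_ : \int[mu]_x (u x + g x) <= _).
  apply: ge0_le_lower_integral => x; first by rewrite lee_fin.
  rewrite /u; move: (g0 x); case: (g x) => [r|//|//] _ /=.
    by rewrite -leeBlDr// le_max lexx.
  by rewrite addey ?leey// -ltNye (lt_le_trans _ (_ : 0 <= _))// le_max lexx orbT.
rewrite ge0_integralD//; apply: leeD => //.
exact: ge0_le_lower_integral.
Qed.

End lower_integral.

Lemma probability_realT {R : realType} (mu : probability R R) :
  (mu : {measure set R -> \bar R}) [set: R] = 1%E.
Proof. exact: probability_setT. Qed.

(** * Expectations of functions of an i.i.d. sample *)

Section iterated_integral.
Context {R : realType}.
Variable mu : probability R R.

Lemma iter_int_ge0 n (f : seq R -> \bar R) :
  (forall s, size s = n -> 0 <= f s)%E -> (0 <= iter_int mu n f)%E.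
Proof.
elim: n f => [|n IH] f f0 /=; first exact: f0.
by apply: integral_ge0 => x _; apply: IH => s sn; apply: f0; rewrite /= sn.
Qed.

Lemma le_iter_int n (f g : seq R -> \bar R) :
  (forall s, size s = n -> 0 <= f s)%E ->
  (forall s, size s = n -> f s <= g s)%E ->
  (iter_int mu n f <= iter_int mu n g)%E.
Proof.
elim: n f g => [|n IH] f g f0 fg /=; first exact: fg.
apply: ge0_le_lower_integral => x.
  by apply: iter_int_ge0 => s sn; apply: f0; rewrite /= sn.
by apply: IH => s sn; [apply: f0|apply: fg]; rewrite /= sn.
Qed.

(* [has_mean n g v]: the nonnegative function [g] of a sample of size [n] has
   finite expectation [v], and every partial expectation is measurable, so that
   the iterated integral is additive at [g]. *)
Fixpoint has_mean (n : nat) (g : seq R -> R) (v : R) : Prop :=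
  if n is n'.+1 then
    exists u : R -> R, [/\ measurable_fun setT u,
      forall x, has_mean n' (fun s => g (x :: s)) (u x) &
      (\int[mu]_x (u x)%:E)%E = v%:E]
  else 0 <= g [::] /\ g [::] = v.

Lemma has_mean_ge0 n g v : has_mean n g v -> 0 <= v.
Proof.
elim: n g v => [|n IH] g v /=; first by move=> [? <-].
move=> [u [mu_ gu uv]]; rewrite -lee_fin -uv.
by apply: integral_ge0 => x _; rewrite lee_fin; exact: IH (gu x).
Qed.

Lemma has_mean_iter_int n g v :
  has_mean n g v -> iter_int mu n (fun s => (g s)%:E) = v%:E.
Proof.
elim: n g v => [|n IH] g v /=; first by move=> [_ ->].
move=> [u [mu_ gu <-]]; apply: eq_integral => x _; exact: IH (gu x).
Qed.

Lemma has_mean_sample_fun n g g' v : (forall s, size s = n -> g s = g' s) ->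
  has_mean n g v -> has_mean n g' v.
Proof.
elim: n g g' v => [|n IH] g g' v gg' /=; first by rewrite gg'.
move=> [u [mu_ gu uv]]; exists u; split=> // x.
by apply: IH (gu x) => s sn; apply: gg'; rewrite /= sn.
Qed.

Lemma has_meanD n g v g' v' : has_mean n g v -> has_mean n g' v' ->
  has_mean n (fun s => g s + g' s) (v + v').
Proof.
elim: n g v g' v' => [|n IH] g v g' v' /=.
  by move=> [g0 <-] [g'0 <-]; rewrite addr_ge0.
move=> [u [mu_ gu uv]] [u' [mu' gu' uv']]; exists (fun x => u x + u' x).
split; [exact: measurable_funD|by move=> x; exact: IH|].
under eq_integral do rewrite EFinD.
rewrite ge0_integralD ?uv ?uv' //.
- by move=> x _; rewrite lee_fin; exact: has_mean_ge0 (gu x).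
- exact/measurable_EFinP.
- by move=> x _; rewrite lee_fin; exact: has_mean_ge0 (gu' x).
- exact/measurable_EFinP.
Qed.

Lemma has_meanZ n c g v : 0 <= c -> has_mean n g v ->
  has_mean n (fun s => c * g s) (c * v).
Proof.
move=> c0; elim: n g v => [|n IH] g v /=; first by move=> [? <-]; rewrite mulr_ge0.
move=> [u [mu_ gu uv]]; exists (fun x => c * u x); split.
- exact: measurable_funM.
- by move=> x; exact: IH.
under eq_integral do rewrite EFinM.
rewrite ge0_integralZl ?uv ?EFinM //.
- exact/measurable_EFinP.
- by move=> x _; rewrite lee_fin; exact: has_mean_ge0 (gu x).
Qed.

Lemma has_mean_cst n c : 0 <= c -> has_mean n (fun=> c) c.
Proof.
move=> c0; elim: n => [//|n IH] /=; exists (fun=> c); split=> //.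
by rewrite integral_cst// probability_realT mule1.
Qed.

Lemma has_mean_bigsum n (I : Type) (r : seq I) (g : I -> seq R -> R) (v : I -> R) :
  (forall i, has_mean n (g i) (v i)) ->
  has_mean n (fun s => \sum_(i <- r) g i s) (\sum_(i <- r) v i).
Proof.
move=> gv; elim: r => [|i r IH].
  rewrite big_nil; apply: has_mean_sample_fun (has_mean_cst n (lexx 0)).
  by move=> s _; rewrite big_nil.
rewrite big_cons; apply: has_mean_sample_fun (has_meanD (gv i) IH).
by move=> s _; rewrite big_cons.
Qed.

(** At each variable [lower_integralD_le] splits off the measurable partial expectation [u] of [g].
    Nothing but its sign is asked of [f], which will be [SCopt k]. *)
Lemma iter_intD_le n (f : seq R -> \bar R) g v : has_mean n g v ->
  (forall s, size s = n -> 0 <= f s)%E ->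
  (iter_int mu n (fun s => f s + (g s)%:E) <= iter_int mu n f + v%:E)%E.
Proof.
elim: n f g v => [|n IH] f g v /=; first by move=> [g0 <-] _.
move=> [u [mu_ gu uv]] f0.
have u0 x : 0 <= u x by exact: has_mean_ge0 (gu x).
have f0' x s : size s = n -> (0 <= f (x :: s))%E.
  by move=> sn; apply: f0; rewrite /= sn.
have g0 n' g' v' : has_mean n' g' v' -> forall s, size s = n' -> 0 <= g' s.
  elim: n' g' v' => [|n' IH'] g' v' /=; first by move=> [? _] [].
  by move=> [u' [_ gu' _]] [//|x s] [sn]; exact: IH' (gu' x) _ sn.
apply: (@le_trans _ _ (\int[mu]_x (iter_int mu n (fun s => f (x :: s))
                                   + (u x)%:E))%E).
  apply: ge0_le_lower_integral => x; last by apply: IH => //; exact: f0'.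
  apply: iter_int_ge0 => s sn; apply: adde_ge0; first exact: f0'.
  by rewrite lee_fin; exact: (g0 _ _ _ (gu x)).
rewrite -uv; apply: lower_integralD_le => //.
- by move=> x; apply: iter_int_ge0; exact: f0'.
- exact/measurable_EFinP.
Qed.

(** The offset carries the induction: drawing [x] turns [c] into [c + h x]. *)
Lemma has_mean_sum n c (h : R -> R) v : 0 <= c -> (forall x, 0 <= h x) ->
  measurable_fun setT h -> (\int[mu]_x (h x)%:E)%E = v%:E ->
  has_mean n (fun s => c + \sum_(x <- s) h x) (c + n%:R * v).
Proof.
move=> c0 h0 mh hv; elim: n c c0 => [|n IH] c c0 /=.
  by rewrite big_nil mul0r !addr0.
exists (fun x => c + h x + n%:R * v); split.
- by apply: measurable_funD => //; apply: measurable_funD.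
- move=> x; apply: has_mean_sample_fun (IH (c + h x) _); last exact: addr_ge0.
  by move=> s _; rewrite big_cons addrA.
have v0 : 0 <= v.
  by rewrite -lee_fin -hv; apply: integral_ge0 => x _; rewrite lee_fin.
rewrite (@eq_integral _ _ _ mu setT (fun x => (c + n%:R * v)%:E + (h x)%:E)%E); last first.
  by move=> x _; rewrite -EFinD; congr EFin; ring.
rewrite ge0_integralD ?hv//.
- rewrite integral_cst// probability_realT mule1 -EFinD -[n.+1%:R]natr1.
  by congr EFin; ring.
- by move=> x _; rewrite lee_fin addr_ge0// mulr_ge0.
- by move=> x _; rewrite lee_fin.
- exact/measurable_EFinP.
Qed.

(* The offset [c] stands for the observations already drawn. *)
Lemma has_mean_sqr_count n c (A : set R) : measurable A ->
  let p := fine (mu A) in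
  has_mean n (fun s => (c + \sum_(x <- s) (\1_A x - p)) ^+ 2)
    (c ^+ 2 + n%:R * (p * (1 - p))).
Proof.
move=> mA p; have pE : mu A = p%:E by rewrite fineK// fin_num_measure.
have p0 : 0 <= p by rewrite /p fine_ge0.
have p1 : p <= 1 by rewrite -lee_fin -pE probability_le1.
elim: n c => [|n IH] c /=.
  by rewrite big_nil mul0r !addr0; split=> //; exact: sqr_ge0.
exists (fun x => (c + (\1_A x - p)) ^+ 2 + n%:R * (p * (1 - p))); split.
- apply: measurable_funD => //; apply: measurable_funX.
  by apply: measurable_funD => //; apply: measurable_funB.
- move=> x; apply: has_mean_sample_fun (IH (c + (\1_A x - p))).
  by move=> s _; rewrite big_cons -addrA.
have K0 : 0 <= n%:R * (p * (1 - p)) by rewrite !mulr_ge0 // subr_ge0.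
(* The square is [(c - p)^2] off [A] and [(c + 1 - p)^2] on [A]; with weights [1 - p] and [p] these
   average to [c^2 + p(1 - p)]. *)
rewrite (@eq_integral _ _ _ mu setT (fun x =>
  ((c - p) ^+ 2 * \1_(~` A) x)%:E + ((c + 1 - p) ^+ 2 * \1_A x)%:E
   + (n%:R * (p * (1 - p)))%:E)%E); last first.
  move=> x _; rewrite -!EFinD indicC indicE; congr EFin.
  by case: (x \in A) => /=; ring.
have m1 (B : set R) (e : R) : measurable B ->
    measurable_fun setT (fun x => (e * \1_B x)%:E).
  by move=> mB; apply/measurable_EFinP; exact: measurable_funM.
have i1 (B : set R) (e : R) : 0 <= e -> measurable B ->
    (\int[mu]_x (e * \1_B x)%:E = e%:E * mu B)%E.
  move=> e0 mB; under eq_integral do rewrite EFinM.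
  by rewrite ge0_integralZl ?integral_indic ?setIT//; apply/measurable_EFinP.
have mC : measurable (~` A) by exact: measurableC.
rewrite ge0_integralD//; first last.
- apply: emeasurable_funD; exact: m1.
- by move=> x _; apply: adde_ge0; rewrite lee_fin mulr_ge0// sqr_ge0.
rewrite ge0_integralD//; first last.
- exact: m1.
- by move=> x _; rewrite lee_fin mulr_ge0// sqr_ge0.
- exact: m1.
- by move=> x _; rewrite lee_fin mulr_ge0// sqr_ge0.
rewrite !i1 ?sqr_ge0// integral_cst// probability_realT mule1 probability_setC// pE.
rewrite -EFinB -!EFinM -!EFinD -[n.+1%:R]natr1; congr EFin; ring.
Qed.

End iterated_integral.

(** * Distance to the nearest facility *)

Section nearest.
Context {R : realType}.
Implicit Types (k : nat) (x z : R) (y : nat -> R).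

(** For [k = 0] the minimum is [+oo], which [fine] sends to 0, so that nonnegativity, the Lipschitz
    bound and measurability hold for every [k]. *)
Definition rdist k x y : R := fine (mindist k x y).

Lemma mindistS k x y :
  mindist k.+1 x y = Order.min (mindist k x y) (`|x - y k|)%:E.
Proof. by rewrite /mindist big_ord_recr. Qed.

Lemma mindist_attained k x y : (0 < k)%N ->
  exists2 j, (j < k)%N & mindist k x y = (`|x - y j|)%:E /\
    forall i, (i < k)%N -> `|x - y j| <= `|x - y i|.
Proof.
elim: k => [//|[|k] IH] _.
  exists 0%N => //; split; last by case.
  by rewrite mindistS /mindist big_ord0 minye.
have [//|j jk [mE jmin]] := IH.
rewrite mindistS mE; have [jle|jgt] := leP `|x - y j| `|x - y k.+1|.
  exists j; first exact: ltnW.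
  split; first by rewrite -EFin_min min_l.
  by move=> i; rewrite ltnS leq_eqVlt => /predU1P[->//|]; exact: jmin.
exists k.+1 => //; split; first by rewrite -EFin_min min_r// ltW.
move=> i; rewrite ltnS leq_eqVlt => /predU1P[->//|ik].
exact: le_trans (ltW jgt) (jmin _ ik).
Qed.

Lemma mindistE k x y : (0 < k)%N -> mindist k x y = (rdist k x y)%:E.
Proof. by move=> /(@mindist_attained _ x y)[j _ [E _]]; rewrite /rdist E. Qed.

Lemma rdist_attained k x y : (0 < k)%N ->
  exists2 j, (j < k)%N & rdist k x y = `|x - y j|.
Proof.
by move=> /(@mindist_attained _ x y)[j jk [E _]]; exists j; rewrite // /rdist E.
Qed.

Lemma rdist_le k x y j : (j < k)%N -> rdist k x y <= `|x - y j|.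
Proof.
move=> jk; have [|i _ [E imin]] := @mindist_attained k x y.
  exact: leq_ltn_trans jk.
by rewrite /rdist E; exact: imin.
Qed.

Lemma rdist_ge0 k x y : 0 <= rdist k x y.
Proof.
case: k => [|k]; first by rewrite /rdist /mindist big_ord0.
by have [//|j _ ->] := @rdist_attained k.+1 x y.
Qed.

Lemma rdist_lipschitz k x z y : rdist k x y <= rdist k z y + `|x - z|.
Proof.
case: k => [|k]; first by rewrite /rdist /mindist !big_ord0 /= add0r.
have [//|j jk ->] := @rdist_attained k.+1 z y.
by rewrite (le_trans (rdist_le _ _ jk))// [leRHS]addrC ler_distD.
Qed.

Lemma rdist_facility_lipschitz k x y y' e : (0 < k)%N ->
  (forall j, (j < k)%N -> `|y j - y' j| <= e) -> rdist k x y <= rdist k x y' + e.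
Proof.
move=> k0 yy'; have [//|j jk ->] := @rdist_attained k x y'.
rewrite (le_trans (rdist_le _ _ jk))// (le_trans (ler_distD (y' j) _ _))//.
by rewrite lerD2l distrC yy'.
Qed.

Lemma measurable_rdist k y : measurable_fun setT (fun x => rdist k x y).
Proof.
suff m : measurable_fun setT (fun x => mindist k x y).
  exact: measurableT_comp m.
elim: k => [|k IH].
  by apply: eq_measurable_fun (measurable_cst +oo%E) => x _; rewrite /mindist big_ord0.
apply: (eq_measurable_fun (fun x => Order.min (mindist k x y) (`|x - y k|)%:E)).
  by move=> x _; rewrite mindistS.
apply: measurable_mine => //; apply/measurable_EFinP.
apply: measurableT_comp => //; exact: measurable_funB.
Qed.

Lemma SC_EFin k (s : seq R) y : (0 < k)%N ->
  SC k s y = ((size s)%:R^-1 * \sum_(x <- s) rdist k x y)%:E.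
Proof.
move=> k0; rewrite /SC EFinM; congr *%E; rewrite -sumEFin.
by apply: eq_bigr => x _; exact: mindistE.
Qed.

Lemma SC_ge0 k (s : seq R) y : (0 < k)%N -> (0 <= SC k s y)%E.
Proof.
move=> k0; rewrite SC_EFin// lee_fin mulr_ge0// sumr_ge0// => x _.
exact: rdist_ge0.
Qed.

Lemma SCopt_ge0 k (s : seq R) : (0 < k)%N -> (0 <= SCopt k s)%E.
Proof. by move=> k0; apply: le_ereal_inf_tmp => _ [y _ <-]; exact: SC_ge0. Qed.

Lemma SCopt_le k (s : seq R) y : (SCopt k s <= SC k s y)%E.
Proof. by apply: ereal_inf_lbound; exists y. Qed.

End nearest.

(** * Order statistics *)

Section order_statistics.
Context {R : realType}.
Implicit Types (s : seq R) (z : R).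

Lemma take_sort_le s i : (i < size s)%N ->
  all (fun x => x <= nth 0 (sort <=%R s) i) (take i.+1 (sort <=%R s)).
Proof.
move=> si; set t := sort <=%R s; have st : size t = size s by rewrite size_sort.
apply/(all_nthP 0) => j; rewrite size_takel ?st// => ji; rewrite nth_take//.
apply: sorted_leq_nth => //; first exact: le_trans.
- exact: sort_sorted le_total _.
- by rewrite inE st (leq_trans ji).
- by rewrite inE st.
Qed.

Lemma drop_sort_ge s i : (i < size s)%N ->
  all (fun x => nth 0 (sort <=%R s) i <= x) (drop i (sort <=%R s)).
Proof.
move=> si; set t := sort <=%R s; have st : size t = size s by rewrite size_sort.
apply/(all_nthP 0) => j; rewrite size_drop st => ji; rewrite nth_drop.
apply: sorted_leq_nth => //; first exact: le_trans.
- exact: sort_sorted le_total _.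
- by rewrite inE st.
- by rewrite inE st -ltn_subRL.
- exact: leq_addr.
Qed.

(** Sorted entries from rank [i] on exceed [z]. With [count_gt_nth_sort], this turns the position of
    an order statistic into a bound on the empirical c.d.f. *)
Lemma count_le_nth_sort s i z : (i < size s)%N ->
  z < nth 0 (sort <=%R s) i -> (count (fun x => (x <= z)%R) s <= i)%N.
Proof.
move=> si zq; set t := sort <=%R s; have st : size t = size s by rewrite size_sort.
have /permP <- : perm_eq t s by rewrite perm_sort.
rewrite -(cat_take_drop i t) count_cat.
have -> : count (fun x => x <= z) (drop i t) = 0%N.
  apply/eqP; rewrite -leqn0 leqNgt -has_count -all_predC.
  by apply: sub_all (drop_sort_ge si) => x qx /=; rewrite -ltNge (lt_le_trans zq).
by rewrite addn0 (leq_trans (count_size _ _))// size_take_min geq_minl.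
Qed.

Lemma count_gt_nth_sort s i z : (i < size s)%N ->
  nth 0 (sort <=%R s) i < z -> (i < count (fun x => (x <= z)%R) s)%N.
Proof.
move=> si qz; set t := sort <=%R s; have st : size t = size s by rewrite size_sort.
have /permP <- : perm_eq t s by rewrite perm_sort.
rewrite -(cat_take_drop i.+1 t) count_cat.
suff -> : count (fun x => x <= z) (take i.+1 t) = i.+1 by exact: leq_addr.
have -> : count (fun x => x <= z) (take i.+1 t) = size (take i.+1 t).
  apply/eqP; rewrite -all_count; apply: sub_all (take_sort_le si) => x xq /=.
  exact: le_trans xq (ltW qz).
by rewrite size_takel// st.
Qed.

Lemma sum_norm_sort_cat s i :
  \sum_(x <- s) `|x| = \sum_(x <- take i (sort <=%R s)) `|x|
                     + \sum_(x <- drop i (sort <=%R s)) `|x|.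
Proof.
by rewrite -big_cat cat_take_drop; apply: perm_big; rewrite perm_sym perm_sort.
Qed.

Lemma sum_seq_ge (I : eqType) (r : seq I) (h : I -> R) c :
  (forall x, x \in r -> c <= h x) -> (size r)%:R * c <= \sum_(x <- r) h x.
Proof.
elim: r => [|x r IH] ch; first by rewrite big_nil mul0r.
rewrite big_cons -[(size (x :: r))%:R]natr1 mulrDl mul1r addrC lerD//.
  by rewrite ch// mem_head.
by apply: IH => x' x'r; rewrite ch// inE x'r orbT.
Qed.

(** A Markov-type bound: the [size s - i] entries from rank [i] on are all at least the order
    statistic. *)
Lemma nth_sort_upper s i : (i < size s)%N ->
  (size s - i)%:R * nth 0 (sort <=%R s) i <= \sum_(x <- s) `|x|.
Proof.
move=> si; rewrite (sum_norm_sort_cat s i).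
apply: (@le_trans _ _ (\sum_(x <- drop i (sort <=%R s)) `|x|)).
  have -> : (size s - i)%N = size (drop i (sort <=%R s)).
    by rewrite size_drop size_sort.
  apply: sum_seq_ge => x xd; have /allP/(_ _ xd) := drop_sort_ge si.
  by move=> /le_trans; apply; exact: ler_norm.
by rewrite lerDr sumr_ge0.
Qed.

Lemma nth_sort_lower s i : (i < size s)%N ->
  i.+1%:R * - nth 0 (sort <=%R s) i <= \sum_(x <- s) `|x|.
Proof.
move=> si; rewrite (sum_norm_sort_cat s i.+1).
apply: (@le_trans _ _ (\sum_(x <- take i.+1 (sort <=%R s)) `|x|)).
  have E : size (take i.+1 (sort <=%R s)) = i.+1.
    by rewrite size_takel// size_sort.
  rewrite -[in leLHS]E.
  apply: sum_seq_ge => x xd; have /allP/(_ _ xd) := take_sort_le si.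
  by rewrite -lerN2 => /le_trans; apply; rewrite lerNl -normrN lerNl ler_norm.
by rewrite lerDl sumr_ge0.
Qed.

(** The summand [v] in the last bound pays for replacing [n.-1] by [n]. *)
Lemma truncn_percentile n (v : R) : (0 < n)%N -> 0 <= v < 1 ->
  let i := Num.truncn (n.-1%:R * v) in
  [/\ (i < n)%N, i%:R <= n%:R * v & n%:R * v < i.+1%:R + v].
Proof.
case: n => [//|n] _ /andP[v0 v1] i /=.
have nv0 : 0 <= n%:R * v by exact: mulr_ge0.
have /andP[il iu] := Num.Theory.truncn_itv nv0.
have iv : i%:R <= n%:R * v by [].
split.
- rewrite -(ltr_nat R) (le_lt_trans iv)// -natr1.
  by rewrite (@le_lt_trans _ _ n%:R)// ?ltrDl// ler_piMr// ltW.
- by rewrite (le_trans iv)// ler_wpM2r// ler_nat.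
- by rewrite -[n.+1%:R]natr1 mulrDl mul1r ltrD2r.
Qed.

(* At least a fixed fraction of the sample lies on either side of the
   [v]-percentile, so that it is controlled by the sample mean of [|x|]. *)
Lemma norm_PM_le (v : nat -> R) s j : (0 < size s)%N -> 0 < v j < 1 ->
  `|PM v s j| <= (2 / v j + (1 - v j)^-1) * ((size s)%:R^-1 * \sum_(x <- s) `|x|).
Proof.
move=> s0 /andP[v0 v1]; rewrite /PM; set n := size s in s0 *.
set i := Num.truncn _; set q := nth _ _ _; set S := \sum_(x <- s) _.
have [|iS iv vi] := @truncn_percentile n (v j) s0; first by rewrite ltW.
rewrite -/i in iS iv vi.
have S0 : 0 <= S by rewrite /S sumr_ge0.
have n0 : 0 < n%:R :> R by rewrite ltr0n.
(* By [iv], at least [n (1 - v j)] observations have rank [i] or more. *)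
have up : (1 - v j) * q * n%:R <= S \/ q <= 0.
  have [q0|q0] := leP q 0; [by right|left].
  apply: le_trans (nth_sort_upper iS); rewrite natrB ?(ltnW iS)// -/n -/q.
  rewrite mulrAC ler_wpM2r ?(ltW q0)//; lra.
(* The factor 2 absorbs the rounding: [n v < i + 1 + v <= 2 (i + 1)]. *)
have lo : v j * - q * n%:R <= 2 * S \/ 0 <= q.
  have [q0|q0] := leP 0 q; [by right|left].
  apply: (@le_trans _ _ (2 * (i.+1%:R * - q))); last first.
    by rewrite ler_pM2l//; exact: nth_sort_lower.
  rewrite mulrA mulrAC ler_wpM2r ?oppr_ge0 ?(ltW q0)//.
  have : 1 <= i.+1%:R :> R by rewrite ler1n.
  lra.
have n1 : 0 <= n%:R^-1 * S by rewrite mulr_ge0 // invr_ge0 ltW.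
rewrite mulrDl ler_norml; apply/andP; split.
  have ? : 0 <= (1 - v j)^-1 * (n%:R^-1 * S) by rewrite mulr_ge0// invr_ge0; lra.
  have : - q <= 2 / v j * (n%:R^-1 * S); last by lra.
  case: lo => [lo|q0]; last first.
    rewrite (@le_trans _ _ 0) ?oppr_le0// mulr_ge0// divr_ge0// ltW//.
  have -> : 2 / v j * (n%:R^-1 * S) = (2 * S) / (v j * n%:R).
    by field; rewrite !gt_eqF.
  by rewrite ler_pdivlMr ?mulr_gt0// mulrA [- q * _]mulrC.
have ? : 0 <= 2 / v j * (n%:R^-1 * S) by rewrite mulr_ge0// divr_ge0// ltW.
have : q <= (1 - v j)^-1 * (n%:R^-1 * S); last by lra.
case: up => [up|q0]; last first.
  by rewrite (le_trans q0)// mulr_ge0// invr_ge0; lra.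
have v1' : 0 < 1 - v j by lra.
have -> : (1 - v j)^-1 * (n%:R^-1 * S) = S / ((1 - v j) * n%:R).
  by field; rewrite !gt_eqF.
by rewrite ler_pdivlMr ?mulr_gt0// mulrA [q * _]mulrC.
Qed.

Lemma sum_indic_ray s z :
  \sum_(x <- s) \1_([set` `]-oo, z]]) x = (count (fun x => x <= z) s)%:R :> R.
Proof.
elim: s => [|x s IH]; first by rewrite big_nil.
rewrite big_cons IH /= natrD indicE; congr (_%:R + _).
by rewrite mem_setE in_itv.
Qed.

End order_statistics.

(** * Integrable functions of one observation *)

Section first_moment.
Context {R : realType}.
Variable mu : probability R R.
Hypothesis int_norm : (\int[mu]_x (`|x|)%:E < +oo)%E.
Import HBSimple.

Lemma integrable_affine_bound (f : R -> R) A : measurable_fun setT f ->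
  (forall x, `|f x| <= A + `|x|) -> mu.-integrable setT (EFin \o f).
Proof.
move=> mf fA; have iA : mu.-integrable setT (EFin \o (fun x : R => A + `|x|)).
  rewrite (_ : _ \o _ = (fun x => (EFin \o cst A) x + (EFin \o Num.norm) x)%E)//.
  apply: integrableD => //.
    by apply: finite_measure_integrable_cst.
  apply/integrableP; split; first exact/measurable_EFinP.
  by under eq_integral do rewrite /= normr_id.
apply: le_integrable iA => //; first exact/measurable_EFinP.
by move=> x _ /=; rewrite lee_fin (le_trans (fA x))// ler_norm.
Qed.

Lemma integrable_rdist k y : mu.-integrable setT (EFin \o (fun x => rdist k x y)).
Proof.
apply: (@integrable_affine_bound _ `|y 0%N|); first exact: measurable_rdist.
move=> x; rewrite ger0_norm ?rdist_ge0//.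
case: k => [|k]; first by rewrite /rdist /mindist big_ord0 addr_ge0.
by rewrite (le_trans (@rdist_le _ _ _ _ 0%N _))// [leRHS]addrC ler_normB.
Qed.

Lemma integrable_scaled_indic (c : R) (A : set R) : measurable A ->
  mu.-integrable setT (EFin \o (fun x => c * \1_A x)).
Proof.
move=> mA; apply: (@integrable_affine_bound _ `|c|).
  exact: measurable_funM.
move=> x; rewrite normrM (@le_trans _ _ `|c|) ?lerDl// ler_piMr//.
by rewrite indicE; case: (x \in A) => /=; rewrite ?normr0 ?normr1.
Qed.

Lemma EFin_RintegralT (f : R -> R) : mu.-integrable setT (EFin \o f) ->
  (\int[mu]_x (f x)%:E)%E = (\int[mu]_x f x)%:E.
Proof. by move=> f_int; rewrite /Rintegral fineK//; exact: integrable_fin_num. Qed.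

Lemma Rintegral_scaled_indic (c : R) (A : set R) : measurable A ->
  \int[mu]_x (c * \1_A x) = c * fine (mu A).
Proof.
move=> mA; rewrite RintegralZl//.
  by rewrite /Rintegral integral_indic// setIT.
apply: (@integrable_affine_bound _ 1) => // x; rewrite indicE.
by case: (x \in A); rewrite /= ?normr0 ?normr1 ?addr_ge0// lerDl.
Qed.

Lemma Rintegral_cstT (c : R) : \int[mu]_x (fun=> c) x = c.
Proof. by rewrite Rintegral_cst// probability_realT mulr1. Qed.

Lemma fine_mu_itv01 (A : set R) : measurable A -> 0 <= fine (mu A) <= 1.
Proof.
move=> mA; rewrite fine_ge0//= -lee_fin fineK ?fin_num_measure//.
exact: probability_le1.
Qed.

(** Simple functions are dense in L^1 and the identity is integrable. Through [phi], the empirical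
    law is controlled by the frequencies of finitely many cells. *)
Lemma finite_valued_approx e : 0 < e ->
  exists (phi : R -> R) (r : seq R),
    [/\ uniq r, measurable_fun setT phi, forall x, phi x \in r &
        \int[mu]_x `|x - phi x| <= e].
Proof.
move=> e0; have iid : mu.-integrable setT (EFin \o (id : R -> R)).
  by apply: (@integrable_affine_bound _ 0) => // x; rewrite add0r.
have [g [ig _ g0]] := approximation_sfun_integrable measurableT iid.
have : \forall n \near \oo,
    (\int[mu]_z `|(EFin \o id) z - (g n z)%:E| < e%:E)%E.
  by apply: (g0 [set u | (u < e%:E)%E]); apply: open_ereal_lt'; rewrite lte_fin.
move=> [N _ /(_ N (leqnn _))] /= gN.
have /finite_seqP[r rE] := fimfunP (g N).
exists (g N), (undup r); split => //.
- exact: undup_uniq.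
- move=> x; rewrite mem_undup; suff : [set` r] (g N x) by [].
  by rewrite -rE; exists x.
- rewrite -lee_fin /Rintegral fineK; first exact: ltW.
  rewrite ge0_fin_numE; last by apply: integral_ge0 => x _; rewrite lee_fin.
  exact: lt_trans gN (ltry _).
Qed.

Definition abs_total (r : seq R) := \sum_(c <- r) `|c|.

Lemma abs_total_ge0 r : 0 <= abs_total r.
Proof. by rewrite /abs_total sumr_ge0. Qed.

Lemma norm_le_abs_total r c : c \in r -> `|c| <= abs_total r.
Proof. by move=> cr; rewrite /abs_total (big_rem _ cr)/= lerDl sumr_ge0. Qed.

Section finite_valued.
Variables (phi : R -> R) (r : seq R).
Hypotheses (ur : uniq r) (mphi : measurable_fun setT phi)
  (phir : forall x, phi x \in r).

Let cell c := phi @^-1` [set c].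

Let mcell c : measurable (cell c).
Proof. by rewrite -[cell c]setTI; exact: mphi. Qed.

Lemma measurable_approx_error : measurable_fun setT (fun x : R => `|x - phi x|).
Proof. by apply: measurableT_comp => //; exact: measurable_funB. Qed.

Lemma integrable_approx_error :
  mu.-integrable setT (EFin \o (fun x : R => `|x - phi x|)).
Proof.
apply: (@integrable_affine_bound _ (abs_total r)); first exact: measurable_approx_error.
move=> x; rewrite normr_id (le_trans (ler_normB _ _))// [leRHS]addrC lerD2l.
exact: norm_le_abs_total.
Qed.

(** Expanding around [g 0] leaves the coefficients [g c - g 0], which a 1-Lipschitz [g] keeps below
    [|c|], whatever the facilities. *)
Lemma comp_finite_valued (g : R -> R) x :
  g (phi x) = g 0 + \sum_(c <- r) (g c - g 0) * \1_(cell c) x.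
Proof.
rewrite (bigD1_seq (phi x))//= big1_seq => [|c /andP[cphi _]].
  by rewrite addr0 indicE mem_set// mulr1 addrC subrK.
by rewrite indicE memNset ?mulr0// /cell /= => E; rewrite E eqxx in cphi.
Qed.

(* One-dimensional Kantorovich duality, easy direction, against the quantised
   law: [g] is replaced by [g \o phi] at the cost of the two error terms, and
   [|u| <= dl + u^2 / dl] trades deviations for variances. *)
Lemma empirical_lower_bound (g : R -> R) (s : seq R) dl :
  (forall x z, g x <= g z + `|x - z|) -> mu.-integrable setT (EFin \o g) ->
  (0 < size s)%N -> 0 < dl ->
  \int[mu]_x g x <= (size s)%:R^-1 * \sum_(x <- s) g x +
    ((size s)%:R^-1 * \sum_(x <- s) `|x - phi x| + \int[mu]_x `|x - phi x|
     + \sum_(c <- r) `|c| * (dl + ((size s)%:R^-1 *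
         \sum_(x <- s) (\1_(cell c) x - fine (mu (cell c)))) ^+ 2 / dl)).
Proof.
move=> glip ig s0 dl0; set n := size s in s0 *.
have n0 : 0 < n%:R :> R by rewrite ltr0n.
pose p c := fine (mu (cell c)).
pose q c : R := n%:R^-1 * \sum_(x <- s) \1_(cell c) x.
have qp c : n%:R^-1 * \sum_(x <- s) (\1_(cell c) x - fine (mu (cell c))) = q c - p c.
  rewrite sumrB big_const_seq count_predT iter_addr_0 mulrBr; congr (_ - _).
  by rewrite -(mulr_natl (fine _)) mulrA mulVf ?mul1r// gt_eqF.
have isum (r' : seq R) : mu.-integrable setT
    (EFin \o (fun x => \sum_(c <- r') (g c - g 0) * \1_(cell c) x)) /\
    \int[mu]_x (\sum_(c <- r') (g c - g 0) * \1_(cell c) x) =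
    \sum_(c <- r') (g c - g 0) * p c.
  elim: r' => [|c r' [IHi IH]].
    split; last first.
      by under eq_Rintegral do rewrite big_nil; rewrite Rintegral_cstT big_nil.
    apply: (@integrable_affine_bound _ 0) => [|x]; last by rewrite big_nil normr0 add0r.
    by apply: measurable_sum => c; exact: measurable_funM.
  split.
    apply: (@eq_integrable _ _ _ _ _ measurableT (fun x => ((g c - g 0) *
        \1_(cell c) x)%:E + (\sum_(c <- r') (g c - g 0) * \1_(cell c) x)%:E)%E).
      by move=> x _; rewrite /= big_cons.
    by apply: integrableD => //; exact: integrable_scaled_indic.
  under eq_Rintegral do rewrite big_cons.
  rewrite RintegralD//; last exact: integrable_scaled_indic.
  by rewrite IH Rintegral_scaled_indic// big_cons.
have [isum_r sum_r] := isum r.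
have ic (c : R) : mu.-integrable setT (EFin \o cst c).
  by apply: finite_measure_integrable_cst.
have upper : \int[mu]_x g x <=
    g 0 + \sum_(c <- r) (g c - g 0) * p c + \int[mu]_x `|x - phi x|.
  pose S x := \sum_(c <- r) (g c - g 0) * \1_(cell c) x.
  have igS : mu.-integrable setT (EFin \o (fun x => g 0 + S x)).
    exact: (integrableD _ (ic (g 0)) isum_r).
  have <- : \int[mu]_x ((g 0 + S x) + `|x - phi x|) =
      g 0 + \sum_(c <- r) (g c - g 0) * p c + \int[mu]_x `|x - phi x|.
    rewrite RintegralD//; last exact: integrable_approx_error.
    by rewrite (RintegralD _ (ic (g 0)) isum_r)// (Rintegral_cstT (g 0)) sum_r.
  apply: le_Rintegral => //.
    exact: (integrableD _ igS integrable_approx_error).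
  by move=> x _; rewrite /S -comp_finite_valued; exact: glip.
have lower : g 0 + \sum_(c <- r) (g c - g 0) * q c <=
    n%:R^-1 * \sum_(x <- s) g x + n%:R^-1 * \sum_(x <- s) `|x - phi x|.
  have -> : g 0 + \sum_(c <- r) (g c - g 0) * q c =
            n%:R^-1 * \sum_(x <- s) g (phi x).
    under [in RHS]eq_bigr do rewrite comp_finite_valued.
    rewrite big_split/= big_const_seq count_predT iter_addr_0 mulrDr.
    rewrite -[in RHS](mulr_natl (g 0)) mulrA mulVf ?mul1r ?gt_eqF//; congr (_ + _).
    rewrite exchange_big/= mulr_sumr; apply: eq_bigr => c _.
    by rewrite -mulr_sumr /q; ring.
  rewrite -mulrDr ler_pM2l ?invr_gt0// -big_split/=.
  by apply: ler_sum => x _; rewrite distrC; exact: glip.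
have dev : \sum_(c <- r) (g c - g 0) * p c <=
    \sum_(c <- r) (g c - g 0) * q c +
    \sum_(c <- r) `|c| * (dl + (n%:R^-1 *
      \sum_(x <- s) (\1_(cell c) x - fine (mu (cell c)))) ^+ 2 / dl).
  rewrite -big_split/=; apply: ler_sum => c _; rewrite qp.
  set u := q c - p c; have -> : p c = q c - u by rewrite /u; ring.
  (* This bound does not depend on [g]; it makes the error uniform in the facilities. *)
  have gc : `|g c - g 0| <= `|c|.
    rewrite ler_norml; have := glip c 0; have := glip 0 c.
    by rewrite subr0 sub0r normrN => *; apply/andP; split; lra.
  have uu : `|u| <= dl + u ^+ 2 / dl.
    rewrite -real_normK ?num_real// -(ler_pM2r dl0) mulrDl divfK ?gt_eqF//.
    have := sqr_ge0 (dl - `|u|); have := normr_ge0 u; nra.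
  have : `|(g c - g 0) * u| <= `|c| * (dl + u ^+ 2 / dl).
    by rewrite normrM ler_pM.
  rewrite ler_norml => /andP[h _]; lra.
lra.
Qed.

End finite_valued.
End first_moment.

(** * Expected costs of large samples *)

Section large_samples.
Context {R : realType}.
Variable mu : probability R R.
Hypothesis int_norm : (\int[mu]_x (`|x|)%:E < +oo)%E.

Lemma has_mean_avg n (h : R -> R) : (0 < n)%N -> (forall x, 0 <= h x) ->
  measurable_fun setT h -> mu.-integrable setT (EFin \o h) ->
  has_mean mu n (fun s => n%:R^-1 * \sum_(x <- s) h x) (\int[mu]_x h x).
Proof.
move=> n0 h0 mh ih.
have := has_meanZ (_ : 0 <= n%:R^-1)
  (has_mean_sum n (lexx 0) h0 mh (EFin_RintegralT ih)).
rewrite invr_ge0 ler0n => /(_ isT).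
rewrite add0r mulrA mulVf ?pnatr_eq0 -?lt0n// mul1r.
by apply: has_mean_sample_fun => s _; rewrite add0r.
Qed.

Lemma has_mean_avg_sqr n (A : set R) : (0 < n)%N -> measurable A ->
  let p := fine (mu A) in
  has_mean mu n (fun s => (n%:R^-1 * \sum_(x <- s) (\1_A x - p)) ^+ 2)
    (n%:R^-1 * (p * (1 - p))).
Proof.
move=> n0 mA p.
have := has_meanZ (_ : 0 <= n%:R^-1 ^+ 2) (has_mean_sqr_count mu n 0 mA).
rewrite sqr_ge0 => /(_ isT).
have -> : n%:R^-1 ^+ 2 * (0 ^+ 2 + n%:R * (p * (1 - p))) = n%:R^-1 * (p * (1 - p)).
  by field; rewrite pnatr_eq0 -lt0n.
by apply: has_mean_sample_fun => s _; rewrite add0r exprMn.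
Qed.

Lemma variance_bound n (A : set R) : measurable A ->
  n%:R^-1 * (fine (mu A) * (1 - fine (mu A))) <= n%:R^-1.
Proof.
move=> mA; have /andP[p0 p1] := fine_mu_itv01 mu mA.
rewrite ler_piMr ?invr_ge0//; nra.
Qed.

Lemma near_inv_small (c e : R) : 0 <= c -> 0 < e ->
  \forall n \near \oo, c * n%:R^-1 <= e.
Proof.
move=> c0 e0; near=> n.
have n0 : 0 < n%:R :> R by near: n; exact: nbhs_infty_gtr.
rewrite ler_pdivrMr// mulrC -ler_pdivrMr//.
by near: n; exact: nbhs_infty_ger.
Unshelve. all: by end_near. Qed.

(** The error [N] of [empirical_lower_bound] does not involve the facilities, so the bound passes to
    their infimum. The mean of [N] is at most four quarters of [e]: twice the approximation error,
    [B * dl], and the variances. *)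
Lemma SCopt_mean_lower k (Dm : R) : (0 < k)%N -> 0 <= Dm ->
  (forall y, Dm <= \int[mu]_x rdist k x y) ->
  forall e : R, 0 < e ->
  \forall n \near \oo, (Dm%:E <= iter_int mu n (SCopt k) + e%:E)%E.
Proof.
move=> k0 Dm0 Dmin e e0.
have e4 : 0 < e / 4 by rewrite divr_gt0.
have [phi [r [ur mphi phir eta_le]]] := finite_valued_approx int_norm e4.
pose B : R := abs_total r; have B0 : 0 <= B by exact: abs_total_ge0.
(* [B + 1] instead of [B], which may vanish. *)
pose dl : R := e / (4 * (B + 1)).
have dl0 : 0 < dl by rewrite divr_gt0// mulr_gt0// ltr_wpDl.
have dlB : B * dl <= e / 4.
  have -> : e / 4 = (B + 1) * dl by rewrite /dl; field; rewrite gt_eqF// ltr_wpDl.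
  by rewrite ler_wpM2r ?lerDl// ltW.
have Bdl0 : 0 <= B / dl by rewrite divr_ge0// ltW.
near=> n.
have n0 : (0 < n)%N by near: n; exact: nbhs_infty_gt.
have nB : B / dl * n%:R^-1 <= e / 4 by near: n; exact: near_inv_small.
pose cell c := phi @^-1` [set c].
have mcell c : measurable (cell c) by rewrite -[cell c]setTI; exact: mphi.
pose p c := fine (mu (cell c)).
pose N (s : seq R) : R := n%:R^-1 * \sum_(x <- s) `|x - phi x| + \int[mu]_x `|x - phi x|
     + \sum_(c <- r) `|c| * (dl + (n%:R^-1 *
         \sum_(x <- s) (\1_(cell c) x - p c)) ^+ 2 / dl).
set eta := \int[mu]_x `|x - phi x| in eta_le *.
have eta0 : 0 <= eta by apply: Rintegral_ge0.
have N_mean : has_mean mu n N (eta + eta +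
    \sum_(c <- r) `|c| * (dl + dl^-1 * (n%:R^-1 * (p c * (1 - p c))))).
  apply: has_meanD.
    apply: has_meanD; last exact: has_mean_cst.
    apply: has_mean_avg => //; first exact: measurable_approx_error.
    exact: (integrable_approx_error int_norm mphi phir).
  apply: has_mean_bigsum => c; apply: has_meanZ => //.
  apply: has_meanD; first by apply: has_mean_cst; exact: ltW.
  have := has_meanZ (_ : 0 <= dl^-1) (has_mean_avg_sqr n0 (mcell c)).
  rewrite invr_ge0 ltW// => /(_ isT); apply: has_mean_sample_fun => s _.
  by rewrite mulrC.
have N_le : eta + eta +
    \sum_(c <- r) `|c| * (dl + dl^-1 * (n%:R^-1 * (p c * (1 - p c)))) <= e.
  have : \sum_(c <- r) `|c| * (dl + dl^-1 * (n%:R^-1 * (p c * (1 - p c)))) <=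
         B * (dl + dl^-1 * n%:R^-1).
    rewrite /B /abs_total mulr_suml; apply: ler_sum => c _.
    rewrite ler_wpM2l// lerD2l ler_wpM2l ?invr_ge0 ?(ltW dl0)//.
    exact: variance_bound.
  have -> : B * (dl + dl^-1 * n%:R^-1) = B * dl + B / dl * n%:R^-1 by ring.
  move: dlB nB eta_le; clearbody dl B eta; lra.
apply: (@le_trans _ _ (iter_int mu n (fun s => SCopt k s + (N s)%:E))%E).
  rewrite -(has_mean_iter_int (has_mean_cst mu n Dm0)).
  apply: le_iter_int => s sn; first by rewrite lee_fin.
  rewrite -leeBlDr//; apply: le_ereal_inf_tmp => _ [y _ <-].
  rewrite SC_EFin// leeBlDr// -EFinD lee_fin (le_trans (Dmin y))//.
  rewrite /N -sn; apply: empirical_lower_bound => //.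
  - by move=> x z; exact: rdist_lipschitz.
  - exact: integrable_rdist.
  - by rewrite sn.
rewrite (le_trans (iter_intD_le N_mean _))// => [s _|].
  exact: SCopt_ge0.
by rewrite leeD2l// lee_fin.
Unshelve. all: by end_near. Qed.

(** * Expected cost of the percentile mechanism *)

Lemma uniform_positive_gap k (f : nat -> R) :
  (forall j, (j < k)%N -> 0 < f j) ->
  exists2 g, 0 < g & forall j, (j < k)%N -> g <= f j.
Proof.
elim: k => [|k IH] f0; first by exists 1.
have [j jk|g g0 gf] := IH; first exact/f0/ltnW.
exists (Num.min g (f k)); first by rewrite lt_min g0 f0.
move=> j; rewrite ltnS leq_eqVlt => /predU1P[->|/gf gj].
  by rewrite ge_min lexx orbT.
by rewrite ge_min gj.
Qed.

Let F := cdfm mu.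
Let ray (z : R) : set R := [set` `]-oo, z]].

Let mray z : measurable (ray z).
Proof. exact: measurable_itv. Qed.

(** The squared deviation of the empirical c.d.f. from [F] at [z], in the form whose mean
    [has_mean_avg_sqr] computes. *)
Let dev n z (s : seq R) : R := (n%:R^-1 * \sum_(x <- s) (\1_(ray z) x - F z)) ^+ 2.

Let dev_count n z s : (0 < n)%N -> size s = n ->
  dev n z s = (n%:R^-1 * (count (fun x => x <= z) s)%:R - F z) ^+ 2.
Proof.
move=> n0 sn; rewrite /dev; congr (_ ^+ 2).
rewrite sumrB sum_indic_ray big_const_seq count_predT iter_addr_0 sn mulrBr.
congr (_ - _); rewrite -(mulr_natl (F z)) mulrA mulVf ?mul1r//.
by rewrite pnatr_eq0 -lt0n.
Qed.

(* Either every percentile is within [ep] of its target, or some empirical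
   c.d.f. deviates from [F] by [gap]; in the latter case the cost is still at
   most [1 + C] times the sample mean of [|x|]. *)
Lemma SC_PM_le k (v y : nat -> R) phi r (s : seq R) ep gap :
  (0 < k)%N -> (forall j, (j < k)%N -> 0 < v j < 1) -> 0 < ep -> 0 < gap ->
  (forall j, (j < k)%N -> v j + gap <= F (y j + ep) /\
                          F (y j - ep) <= v j - 2 * gap) ->
  (forall x, phi x \in r) ->
  (0 < size s)%N -> (size s)%:R^-1 <= gap ->
  (size s)%:R^-1 * \sum_(x <- s) rdist k x (PM v s) <=
  (size s)%:R^-1 * \sum_(x <- s) rdist k x y + ep +
  (1 + (2 / v 0%N + (1 - v 0%N)^-1)) *
    ((size s)%:R^-1 * \sum_(x <- s) `|x - phi x| +
     abs_total r / gap ^+ 2 *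
       \sum_(j < k) (dev (size s) (y j + ep) s + dev (size s) (y j - ep) s)).
Proof.
move=> k0 v01 ep0 gap0 Fgap phir; set n := size s => n0 ngap.
have nR0 : 0 < n%:R :> R by rewrite ltr0n.
set C := 2 / v 0%N + (1 - v 0%N)^-1; pose B : R := abs_total r; rewrite -/B.
have /andP[v00 v01'] := v01 _ k0.
have C0 : 0 <= C by rewrite /C addr_ge0// ?divr_ge0 ?invr_ge0 ?subr_ge0 ?(ltW v00)// ltW.
have B0 : 0 <= B by exact: abs_total_ge0.
have dev0 z : 0 <= dev n z s by exact: sqr_ge0.
set Sdev := \sum_(j < k) _.
have Sdev0 : 0 <= Sdev by apply: sumr_ge0 => j _; exact: addr_ge0.
set T := n%:R^-1 * \sum_(x <- s) `|x - phi x|.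
have T0 : 0 <= T by rewrite mulr_ge0 ?invr_ge0// sumr_ge0.
have BS0 : 0 <= B / gap ^+ 2 * Sdev.
  by rewrite mulr_ge0// divr_ge0// sqr_ge0.
have avg_add (h : R -> R) c :
    n%:R^-1 * \sum_(x <- s) (h x + c) = n%:R^-1 * \sum_(x <- s) h x + c.
  rewrite big_split/= big_const_seq count_predT iter_addr_0 mulrDr -(mulr_natl c).
  by rewrite [X in _ + X]mulrA mulVf ?mul1r// gt_eqF.
have avg_le (h h' : R -> R) : (forall x, h x <= h' x) ->
    n%:R^-1 * \sum_(x <- s) h x <= n%:R^-1 * \sum_(x <- s) h' x.
  by move=> hh; rewrite ler_wpM2l ?invr_ge0 ?(ltW nR0)// ler_sum.
have [good|] := pselect (forall j, (j < k)%N -> `|PM v s j - y j| <= ep).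
  rewrite (@le_trans _ _ (n%:R^-1 * \sum_(x <- s) rdist k x y + ep))//.
    rewrite -avg_add; apply: avg_le => x.
    exact: rdist_facility_lipschitz.
  by rewrite lerDl mulr_ge0// addr_ge0.
move=> /existsNP[j /not_implyP[jk /negP]]; rewrite -ltNge => bad.
have /andP[vj0 vj1] := v01 _ jk; have [Fu Fl] := Fgap _ jk.
have [|iS iv vi] := @truncn_percentile _ n (v j) n0; first by rewrite ltW.
have devj : gap ^+ 2 <= dev n (y j + ep) s + dev n (y j - ep) s.
  have sqr_gap (u : R) : gap <= u \/ gap <= - u -> gap ^+ 2 <= u ^+ 2.
    by case=> gu; [|rewrite -(sqrrN u)];
      rewrite ler_pXn2r ?nnegrE ?(ltW gap0) ?(le_trans (ltW gap0) gu).
  (* Too far right: at [y j + ep] the empirical c.d.f. is at most [v j], hence [gap] below [F]. *)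
  have [hi|lo] := ltP (y j + ep) (PM v s j).
    apply: ler_wpDr => //; rewrite dev_count//; apply: sqr_gap; right.
    have cnt := count_le_nth_sort iS hi; set m := count _ _ in cnt *.
    have : n%:R^-1 * m%:R <= v j.
      by rewrite ler_pdivrMl// (le_trans _ iv)// ler_nat.
    lra.
  (* Too far left: at [y j - ep] the empirical c.d.f. is at least [v j - 1/n]. Rounding costs
     [1/n <= gap], whence the [2 * gap] in the hypothesis. *)
  have {}lo : PM v s j < y j - ep.
    move: bad; rewrite ltr_normr => /orP[|]; lra.
  apply: ler_wpDl => //; rewrite dev_count//; apply: sqr_gap; left.
  have cnt := count_gt_nth_sort iS lo; set m := count _ _ in cnt *.
  have : v j - n%:R^-1 <= n%:R^-1 * m%:R.
    rewrite ler_pdivlMl// mulrBr mulfV ?gt_eqF// lerBlDr.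
    have : (Num.truncn (n.-1%:R * v j)).+1%:R <= m%:R :> R by rewrite ler_nat.
    lra.
  lra.
have gapS : gap ^+ 2 <= Sdev.
  apply: le_trans devj _; rewrite /Sdev (bigD1 (Ordinal jk))//= lerDl.
  by apply: sumr_ge0 => i _; exact: addr_ge0.
(* Chebyshev's inequality without an indicator: on the bad event [Sdev] is at least [gap ^+ 2], so
   it can multiply the constant [B]. *)
have B_le : B <= B / gap ^+ 2 * Sdev.
  by rewrite mulrAC ler_pdivlMr ?exprn_gt0// ler_wpM2l.
have mean_le : n%:R^-1 * \sum_(x <- s) `|x| <= T + B.
  rewrite /T -avg_add; apply: avg_le => x.
  rewrite -[in leLHS](subrK (phi x) x) (le_trans (ler_normD _ _))// lerD2l.
  exact: norm_le_abs_total.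
(* Facility 0 alone already gives this bound, by [norm_PM_le]. *)
have cost_le : n%:R^-1 * \sum_(x <- s) rdist k x (PM v s) <=
    (1 + C) * (n%:R^-1 * \sum_(x <- s) `|x|).
  rewrite mulrDl mul1r (@le_trans _ _ (n%:R^-1 * \sum_(x <- s) `|x| + `|PM v s 0|))//.
    rewrite -avg_add; apply: avg_le => x.
    by rewrite (le_trans (rdist_le _ _ k0))// ler_normB.
  by rewrite lerD2l; apply: norm_PM_le => //; exact: v01.
rewrite (le_trans cost_le)// (@le_trans _ _ ((1 + C) * (T + B)))//.
  by rewrite ler_wpM2l// addr_ge0.
have ? : 0 <= n%:R^-1 * \sum_(x <- s) rdist k x y.
  by rewrite mulr_ge0 ?invr_ge0 ?(ltW nR0)// sumr_ge0// => x _; exact: rdist_ge0.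
apply: ler_wpDl; first by rewrite addr_ge0 ?(ltW ep0).
by apply: ler_wpM2l; [rewrite addr_ge0|rewrite lerD2l].
Qed.

(** The bound of [SC_PM_le] is integrated. First [phi] is chosen so that [1 + C] times its error is
    at most [e / 4]; then [n] is taken large enough to make the variances small. *)
Lemma SC_PM_mean_upper k (v y : nat -> R) : (0 < k)%N ->
  (forall j, (j < k)%N -> 0 < v j < 1) ->
  (forall j ep, (j < k)%N -> 0 < ep -> F (y j - ep) < v j < F (y j + ep)) ->
  forall e : R, 0 < e ->
  \forall n \near \oo, (iter_int mu n (fun s => SC k s (PM v s)) <=
                        (\int[mu]_x rdist k x y + e)%:E)%E.
Proof.
move=> k0 v01 Fv e e0.
(* The lower gap is halved because [SC_PM_le] asks for [2 * gap] on that side. *)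
have [g g0 gle] : exists2 g, 0 < g & forall j, (j < k)%N ->
    g <= Num.min (F (y j + e / 4) - v j) ((v j - F (y j - e / 4)) / 2).
  apply: uniform_positive_gap => j jk.
  have /andP[l u] : F (y j - e / 4) < v j < F (y j + e / 4).
    by apply: Fv => //; rewrite divr_gt0.
  by rewrite lt_min subr_gt0 u divr_gt0 ?subr_gt0.
pose C : R := 2 / v 0%N + (1 - v 0%N)^-1.
have /andP[v00 v01'] := v01 _ k0.
have C0 : 0 <= C by rewrite /C addr_ge0// ?divr_ge0 ?invr_ge0 ?subr_ge0 ?(ltW v00)// ltW.
have C1 : 0 < 1 + C by rewrite ltr_pwDl.
have eC : 0 < e / (4 * (1 + C)) by rewrite divr_gt0// mulr_gt0.
have [phi [r [ur mphi phir eta_le]]] := finite_valued_approx int_norm eC.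
pose B : R := abs_total r; have B0 : 0 <= B by exact: abs_total_ge0.
(* There are [2 * k] deviation terms, each of variance at most [1/n]. *)
pose W : R := (1 + C) * (B / g ^+ 2 * (2 * k%:R)).
have W0 : 0 <= W by rewrite /W !mulr_ge0 ?(ltW C1)// invr_ge0 sqr_ge0.
near=> n.
have n0 : (0 < n)%N by near: n; exact: nbhs_infty_gt.
have ng : n%:R^-1 <= g.
  by rewrite -[leLHS]mul1r; near: n; exact: near_inv_small.
have nW : W * n%:R^-1 <= e / 4.
  by near: n; apply: near_inv_small => //; rewrite divr_gt0.
pose U (s : seq R) : R := n%:R^-1 * \sum_(x <- s) rdist k x y + e / 4 +
  (1 + C) * (n%:R^-1 * \sum_(x <- s) `|x - phi x| +
     B / g ^+ 2 * \sum_(j < k) (dev n (y j + e / 4) s + dev n (y j - e / 4) s)).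
pose var z := n%:R^-1 * (F z * (1 - F z)).
have U_mean : has_mean mu n U (\int[mu]_x rdist k x y + e / 4 +
    (1 + C) * (\int[mu]_x `|x - phi x| +
      B / g ^+ 2 * \sum_(j < k) (var (y j + e / 4) + var (y j - e / 4)))).
  apply: has_meanD.
    apply: has_meanD; last by apply: has_mean_cst; rewrite divr_ge0// ltW.
    apply: has_mean_avg => //; [|exact: measurable_rdist|exact: integrable_rdist].
    by move=> x; exact: rdist_ge0.
  apply: has_meanZ; first exact: ltW.
  apply: has_meanD.
    apply: has_mean_avg => //; first exact: measurable_approx_error.
    exact: (integrable_approx_error int_norm mphi phir).
  apply: has_meanZ; first by rewrite divr_ge0// sqr_ge0.
  apply: has_mean_bigsum => j; apply: has_meanD; exact: has_mean_avg_sqr.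
apply: (@le_trans _ _ (iter_int mu n (fun s => (U s)%:E))).
  apply: le_iter_int => s sn; first exact: SC_ge0.
  rewrite SC_EFin// lee_fin /U -sn; apply: SC_PM_le => //.
  - by rewrite divr_gt0.
  - move=> j jk; have := gle j jk; rewrite le_min => /andP[].
    rewrite ler_pdivlMr// => *; split; lra.
  - by rewrite sn.
  - by rewrite sn.
rewrite (has_mean_iter_int U_mean) lee_fin -addrA lerD2l.
have var_le z : var z <= n%:R^-1 by exact: variance_bound.
have sum_le : \sum_(j < k) (var (y j + e / 4) + var (y j - e / 4)) <=
    2 * k%:R * n%:R^-1.
  rewrite (@le_trans _ _ (\sum_(j < k) (n%:R^-1 + n%:R^-1)))//.
    by apply: ler_sum => j _; exact: lerD.
  rewrite sumr_const card_ord -mulr_natl; lra.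
have : (1 + C) * (\int[mu]_x `|x - phi x| +
      B / g ^+ 2 * \sum_(j < k) (var (y j + e / 4) + var (y j - e / 4))) <=
   (1 + C) * (e / (4 * (1 + C)) + B / g ^+ 2 * (2 * k%:R * n%:R^-1)).
  rewrite ler_wpM2l ?(ltW C1)// lerD// ler_wpM2l//.
  by rewrite divr_ge0// sqr_ge0.
have -> : (1 + C) * (e / (4 * (1 + C)) + B / g ^+ 2 * (2 * k%:R * n%:R^-1)) =
    e / 4 + W * n%:R^-1.
  by rewrite /W; field; rewrite !gt_eqF// ltr0n.
move: nW; clearbody W; lra.
Unshelve. all: by end_near. Qed.

(** The mechanism costs on average at most [D + e'], the optimum at least [D - e'] and no more than
    the mechanism. As [D > 0], the ratio tends to 1. *)
Lemma Bar_PM_cvg1 k (v y : nat -> R) : (0 < k)%N ->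
  (forall j, (j < k)%N -> 0 < v j < 1) ->
  (forall j ep, (j < k)%N -> 0 < ep -> F (y j - ep) < v j < F (y j + ep)) ->
  0 < \int[mu]_x rdist k x y ->
  (forall y', \int[mu]_x rdist k x y <= \int[mu]_x rdist k x y') ->
  Bar k mu (PM v) @ \oo --> (1 : R).
Proof.
move=> k0 v01 Fv; set D := \int[mu]_x rdist k x y => D0 Dmin.
apply/cvgrPdist_le => e e0.
(* The first term keeps the denominator above [D / 2]; the second makes the difference of the costs,
   at most [2 * e'], no more than [e * (D / 2)]. *)
pose e' : R := Num.min (D / 2) (e * D / 4).
have e'0 : 0 < e' by rewrite lt_min !divr_gt0// mulr_gt0.
have e'D : e' <= D / 2 by rewrite ge_min lexx.
have e'e : e' <= e * D / 4 by rewrite ge_min lexx orbT.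
near=> n.
have hi : (iter_int mu n (fun s => SC k s (PM v s)) <= (D + e')%:E)%E.
  by near: n; exact: SC_PM_mean_upper.
have lo : (D%:E <= iter_int mu n (SCopt k) + e'%:E)%E.
  by near: n; apply: SCopt_mean_lower => //; exact: ltW.
have ab : (iter_int mu n (SCopt k) <= iter_int mu n (fun s => SC k s (PM v s)))%E.
  apply: le_iter_int => s _; [exact: SCopt_ge0|exact: SCopt_le].
have b0 : (0 <= iter_int mu n (SCopt k))%E.
  by apply: iter_int_ge0 => s _; exact: SCopt_ge0.
rewrite /Bar; move: hi lo ab b0.
(* The bounds exclude infinite values, so [fine] loses nothing in [Bar]. *)
case: (iter_int mu n (fun s => SC k s (PM v s))) => [a|//|]; last first.
  by case: (iter_int mu n (SCopt k)).
case: (iter_int mu n (SCopt k)) => [b|//|//] /=.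
rewrite -EFinD !lee_fin => hi lo ab b0.
have bD : D / 2 <= b by lra.
have b0' : 0 < b by lra.
have -> : 1 - a / b = - ((a - b) / b) by field; rewrite gt_eqF.
rewrite normrN ger0_norm ?divr_ge0 ?subr_ge0// ler_pdivrMr//.
have : e * (D / 2) <= e * b by rewrite ler_pM2l.
lra.
Unshelve. all: by end_near. Qed.

End large_samples.

(** * Reduction of the Wasserstein problem to the k-median problem *)

Section wasserstein.
Context {R : realType}.
Variable mu : probability R R.
Hypothesis int_norm : (\int[mu]_x (`|x|)%:E < +oo)%E.

(* The second marginal charges only the points [y j], so under any coupling the
   transport cost is at least the distance to the nearest of them. *)
Lemma W1_discr_ge k (w y : nat -> R) : (0 < k)%N ->
  ((\int[mu]_x rdist k x y)%:E <= W1 mu (discr k w y))%E.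
Proof.
move=> k0; apply: le_ereal_inf_tmp => _ [pi [pi1 pi2] <-].
have mr : measurable_fun setT (fun x : R => (rdist k x y)%:E).
  by apply/measurable_EFinP; exact: measurable_rdist.
rewrite -(EFin_RintegralT (integrable_rdist int_norm k y)).
have -> : (\int[mu]_x (rdist k x y)%:E = \int[pi]_z (rdist k z.1 y)%:E)%E.
  rewrite -(ge0_integral_pushforward (@measurable_fst _ _ R R) pi measurableT mr).
    apply: eq_measure_integral => A mA _; apply: etrans (esym (pi1 A mA)) _.
    rewrite /pushforward; congr (pi _).
    by apply/seteqP; split => z /=; [case|].
  by move=> x _; rewrite lee_fin rdist_ge0.
apply: ae_ge0_le_integral => //.
- by move=> z _; rewrite lee_fin rdist_ge0.
- exact: (measurableT_comp mr measurable_fst).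
- apply/measurable_EFinP; apply: measurableT_comp => //.
  exact: measurable_funB.
pose A := [set x | exists2 j, (j < k)%N & x = y j].
have mA : measurable A.
  have -> : A = \big[setU/set0]_(j < k) [set y j].
    rewrite -(bigcup_mkord k (fun j => [set y j])); apply/seteqP; split => x /=.
      by move=> [j jk ->]; exists j.
    by move=> [j jk ->]; exists j.
  by apply: bigsetU_measurable => j _; exact: measurable_set1.
exists (setT `*` ~` A); split.
- by apply: measurableX => //; exact: measurableC.
- apply: etrans (pi2 _ (measurableC mA)) _.
  rewrite /discr big1// => j _; rewrite diracE memNset ?mule0//.
  by apply; exists j.
- move=> z /= zP; split=> // -[j jk zj]; apply: zP => _.
  by rewrite lee_fin zj; exact: rdist_le.
Qed.

(** A measurable choice of nearest facility, ties going to the smaller index; [x |-> y (J x)] will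
    be the transport map. *)
Lemma nearest_index k (y : nat -> R) : (0 < k)%N ->
  exists J : R -> nat, [/\ measurable_fun setT J, forall x, (J x < k)%N &
    forall x, `|x - y (J x)| = rdist k x y].
Proof.
elim: k => [//|[|k] IH] _.
  exists (fun=> 0%N); split => // x.
  by have [//|[|//] _ ->] := @rdist_attained _ 1 x y.
have [//|J [mJ Jk JE]] := IH.
exists (fun x => if rdist k.+1 x y <= `|x - y k.+1| then J x else k.+1); split.
- apply: measurable_fun_ifT => //; apply: measurable_fun_ler.
    exact: measurable_rdist.
  by apply: measurableT_comp => //; exact: measurable_funB.
- by move=> x; case: ifP => // _; exact: leqW (Jk x).
- move=> x; have -> : rdist k.+2 x y = Num.min (rdist k.+1 x y) `|x - y k.+1|.
    by rewrite [in LHS]/rdist mindistS mindistE// -EFin_min.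
  by case: leP => // _; exact: JE.
Qed.

(** The coupling is the law of [(x, y (J x))]. Weights are the masses of the sets [J = j], indexed
    by facility and not by position, so repeated positions are harmless. *)
Lemma W1_discr_le k (y : nat -> R) : (0 < k)%N ->
  exists2 w, Pk_weights k w &
    (W1 mu (discr k w y) <= (\int[mu]_x rdist k x y)%:E)%E.
Proof.
move=> k0; have [J [mJ Jk JE]] := @nearest_index k y k0.
have mJj j : measurable (J @^-1` [set j]) by rewrite -[_ @^-1` _]setTI; exact: mJ.
pose T x := y (J x).
have mT : measurable_fun setT T by apply: measurableT_comp mJ.
pose w j := fine (mu (J @^-1` [set j])).
have wE j : (mu : {measure set R -> \bar R}) (J @^-1` [set j]) = (w j)%:E.
  by rewrite fineK// fin_num_measure.
have muT B : measurable B -> mu (T @^-1` B) = discr k w y B.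
  move=> mB; rewrite /discr.
  have mTB : measurable (T @^-1` B) by rewrite -[_ @^-1` _]setTI; exact: mT.
  have <- : (\int[mu]_x (\1_(T @^-1` B) x)%:E = mu (T @^-1` B))%E.
    by rewrite integral_indic// setIT.
  rewrite (@eq_integral _ _ _ mu setT (fun x => \sum_(j < k)
    ((\1_B (y j))%:E * (\1_(J @^-1` [set (j : nat)]) x)%:E))%E); last first.
    move=> x _; rewrite (bigD1 (Ordinal (Jk x)))//= big1 => [|j jJ].
      rewrite adde0 [X in (_ * X%:E)%E]indicE mem_set// mule1 !indicE.
      by congr (_%:R%:E); apply/idP/idP; rewrite !inE.
    rewrite [X in (_ * X%:E)%E]indicE memNset ?mule0// => /= Jj.
    by move: jJ; rewrite -(inj_eq val_inj)/= Jj eqxx.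
  rewrite ge0_integral_sum//; last first.
    by move=> j; apply/measurable_EFinP; exact: measurable_funM.
  apply: eq_bigr => j _; rewrite ge0_integralZl ?lee_fin//.
  - by rewrite integral_indic// setIT wE diracE indicE muleC.
  - exact/measurable_EFinP.
have mX : measurable_fun setT (fun x : R => (x, T x)).
  exact: measurable_fun_pair.
pose X : {mfun R >-> (R * R)%type} := mfun_Sub (mem_set mX).
exists w.
  split; first by move=> j _; apply: fine_ge0.
  have := muT _ measurableT; rewrite preimage_setT probability_realT /discr => E.
  apply: EFin_inj; rewrite -sumEFin E; apply: eq_bigr => j _.
  by rewrite diracT mule1.
apply: (@le_trans _ _ (\int[distribution mu X]_z (`|z.1 - z.2|)%:E)%E).
  apply: ereal_inf_lbound; exists (distribution mu X) => //; split => A mA.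
    rewrite /distribution /pushforward; congr (mu _).
    by apply/seteqP; split => x /=; [case|].
  rewrite -muT// /distribution /pushforward; congr (mu _).
  by apply/seteqP; split => x /=; [case|].
rewrite ge0_integral_distribution//.
- rewrite -(EFin_RintegralT (integrable_rdist int_norm k y)) le_eqVlt.
  by apply/orP; left; apply/eqP; apply: eq_integral => x _ /=; rewrite JE.
- apply/measurable_EFinP; apply: measurableT_comp => //.
  exact: measurable_funB.
Qed.

(** Chain: the mean distance to [y] is at most the cost of [nu], which is at most that of the law
    built on [y'] by [W1_discr_le], which is at most the mean distance to [y']. *)
Lemma W1_minimizer_k_median k (w y : nat -> R) : (0 < k)%N ->
  (forall w' x' : nat -> R, Pk_weights k w' ->
     (W1 mu (discr k w y) <= W1 mu (discr k w' x'))%E) ->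
  forall y', \int[mu]_x rdist k x y <= \int[mu]_x rdist k x y'.
Proof.
move=> k0 opt y'; have [w' Pw' w'le] := @W1_discr_le k y' k0.
rewrite -lee_fin (le_trans (W1_discr_ge w y k0))//.
exact: le_trans (opt _ _ Pw') w'le.
Qed.

End wasserstein.

(** * First-order conditions for the k-median problem *)

Section first_order.
Context {R : realType}.
Variable mu : probability R R.
Hypothesis int_norm : (\int[mu]_x (`|x|)%:E < +oo)%E.

(** The common integration step of the three perturbation arguments below, each of which bounds the
    change of cost by three indicators. *)
Lemma Rintegral_rdist_le k (y y' : nat -> R) (a b c : R) (A B C : set R) :
  measurable A -> measurable B -> measurable C ->
  (forall x, rdist k x y' <= rdist k x y + a * \1_A x + b * \1_B x + c * \1_C x) ->
  \int[mu]_x rdist k x y' <= \int[mu]_x rdist k x y +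
    a * fine (mu A) + b * fine (mu B) + c * fine (mu C).
Proof.
move=> mA mB mC le.
have iA := integrable_scaled_indic int_norm a mA.
have iB := integrable_scaled_indic int_norm b mB.
have iC := integrable_scaled_indic int_norm c mC.
have iy := integrable_rdist int_norm k y.
have i1 := integrableD measurableT iy iA.
have i2 := integrableD measurableT i1 iB.
have i3 := integrableD measurableT i2 iC.
rewrite -!(Rintegral_scaled_indic int_norm)//.
rewrite -(RintegralD _ iy iA)// -(RintegralD _ i1 iB)// -(RintegralD _ i2 iC)//.
apply: le_Rintegral => //; first exact: integrable_rdist.
Qed.

Variables (k : nat) (y : nat -> R).
Hypothesis y_sorted : forall i j, (i <= j)%N -> (j < k)%N -> y i <= y j.

Let F := cdfm mu.

Definition midpoint j := (y j + y j.+1) / 2.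

(* [lower_cells j] is the union of the Voronoi cells of [y 0], ..., [y j.-1]. *)
Definition lower_cells j : set R :=
  if j is j'.+1 then (if (j < k)%N then [set` `]-oo, midpoint j']] else setT)
  else set0.

Lemma measurable_lower_cells j : measurable (lower_cells j).
Proof.
case: j => [|j]; first exact: measurable0.
rewrite /lower_cells; case: (j.+1 < k)%N => //; exact: measurable_itv.
Qed.

Lemma lower_cellsP j x : (0 < j)%N -> (j < k)%N ->
  lower_cells j x <-> x <= midpoint j.-1.
Proof. by case: j => [//|j] _ jk /=; rewrite jk /= in_itv. Qed.

Lemma lower_cells_full j : (0 < j)%N -> (k <= j)%N -> lower_cells j = setT.
Proof. by case: j => [//|j] _ kj /=; rewrite ltnNge kj. Qed.

Lemma lower_cells_mono j x : (j < k)%N -> lower_cells j x -> lower_cells j.+1 x.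
Proof.
move=> jk; case: (posnP j) => [->//|j0] /(lower_cellsP x j0 jk) xm.
have [jk1|jk1] := ltnP j.+1 k; last by rewrite lower_cells_full.
apply/lower_cellsP => //=; apply: le_trans xm _.
rewrite /midpoint prednK// ler_pM2r ?invr_gt0//.
by apply: lerD; apply: y_sorted => //; exact: leq_pred.
Qed.

Definition move_facility j z : nat -> R := fun i => if i == j then z else y i.

(** Since [y] is sorted, the midpoints with the two neighbours rule out every other facility. *)
Lemma rdist_cell j x : (j < k)%N -> ~ lower_cells j x -> lower_cells j.+1 x ->
  rdist k x y = `|x - y j|.
Proof.
move=> jk nl u; apply/eqP; rewrite eq_le rdist_le//=.
have [|i ik ->] := @rdist_attained _ k x y; first exact: leq_ltn_trans jk.
have [ij|ji|->//] := ltngtP i j.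
  have j0 : (0 < j)%N by exact: leq_ltn_trans ij.
  have : midpoint j.-1 < x.
    by rewrite ltNge; apply/negP => h; apply: nl; apply/lower_cellsP.
  rewrite /midpoint prednK// => xm.
  have yi : y i <= y j.-1.
    by apply: y_sorted; rewrite ?(leq_ltn_trans (leq_pred _))// -ltnS prednK.
  have yj : y j.-1 <= y j by apply: y_sorted => //; exact: leq_pred.
  rewrite (@ger0_norm _ (x - y i)) ?ler_norml; last by lra.
  by apply/andP; split; lra.
have jk1 : (j.+1 < k)%N by exact: leq_ltn_trans ji ik.
move: u => /(lower_cellsP x (ltn0Sn j) jk1); rewrite /midpoint /= => xm.
have yi : y j.+1 <= y i by exact: y_sorted.
have yj : y j <= y j.+1 by exact: y_sorted.
rewrite (@ler0_norm _ (x - y i)) ?ler_norml; last by lra.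
by apply/andP; split; lra.
Qed.

(** Off the cell of [y j], an adjacent facility is at least as close as [y j], so one that stays in
    place attains the minimum. *)
Lemma rdist_not_cell j x z : (j < k)%N -> lower_cells j x \/ ~ lower_cells j.+1 x ->
  rdist k x (move_facility j z) <= rdist k x y.
Proof.
move=> jk out; have [|i ik E] := @rdist_attained _ k x y.
  exact: leq_ltn_trans jk.
have other i' : (i' < k)%N -> i' != j -> `|x - y i'| <= `|x - y i| ->
    rdist k x (move_facility j z) <= rdist k x y.
  move=> i'k i'j le; rewrite E (le_trans _ le)//.
  by have := rdist_le x (move_facility j z) i'k; rewrite /move_facility (negbTE i'j).
have [ij|ij] := eqVneq i j; last exact: (other i).
subst i; case: out => [l|nu].
  have j0 : (0 < j)%N by rewrite lt0n; apply/eqP => j0; move: l; rewrite j0.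
  have yj : y j.-1 <= y j by apply: y_sorted => //; exact: leq_pred.
  move: l => /(lower_cellsP x j0 jk); rewrite /midpoint prednK// => xm.
  apply: (other j.-1); [exact: leq_ltn_trans (leq_pred _) jk| |].
    by rewrite neq_ltn prednK// leqnn.
  rewrite (@ler0_norm _ (x - y j)) ?ler_norml; last by lra.
  by apply/andP; split; lra.
have jk1 : (j.+1 < k)%N.
  by rewrite ltnNge; apply/negP => kj; apply: nu; rewrite lower_cells_full.
have yj : y j <= y j.+1 by exact: y_sorted.
have : midpoint j < x.
  by rewrite ltNge; apply/negP => h; apply: nu; apply/lower_cellsP.
rewrite /midpoint => xm.
apply: (other j.+1) => //; first by rewrite neq_ltn ltnSn orbT.
rewrite (@ger0_norm _ (x - y j)) ?ler_norml; last by lra.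
by apply/andP; split; lra.
Qed.

Hypothesis y_opt :
  forall y', \int[mu]_x rdist k x y <= \int[mu]_x rdist k x y'.

Let G j := fine (mu (lower_cells j)).

Let mray (t : R) : measurable [set` `]-oo, t]].
Proof. exact: measurable_itv. Qed.

Let cdfmE (t : R) : fine (mu [set` `]-oo, t]]) = F t.
Proof. by []. Qed.

Let indic_ray (t x : R) : \1_([set` `]-oo, t]]) x = (x <= t)%R%:R :> R.
Proof. by rewrite indicE mem_setE in_itv. Qed.

(* Moving [y j] by [h] changes the cost by [+h] or [-h] on its cell, according
   to the side of [y j] on which the observation lies, up to a neighbourhood of
   [y j] of size [h]. *)
Lemma moved_right_cost j h : (j < k)%N -> 0 < h ->
  G j.+1 - G j <= 2 * (F (y j + h) - G j).
Proof.
move=> jk h0.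
(* The coefficients sum to 0 on [lower_cells j]; on the cell of [y j] they give [+h] up to [y j + h]
   and [-h] beyond; above the cell they are nonnegative. *)
have le x : rdist k x (move_facility j (y j + h)) <= rdist k x y +
    2 * h * \1_([set` `]-oo, y j + h]]) x + - h * \1_(lower_cells j.+1) x +
    - h * \1_(lower_cells j) x.
  have lt_cell : lower_cells j x -> x <= y j + h.
    move=> l; have j0 : (0 < j)%N by rewrite lt0n; apply/eqP => j0; move: l; rewrite j0.
    move: l => /(lower_cellsP x j0 jk); rewrite /midpoint prednK//.
    by have : y j.-1 <= y j by [apply: y_sorted => //; exact: leq_pred]; lra.
  rewrite indic_ray !indicE.
  have [l|nl] := pselect (lower_cells j x).
    rewrite (mem_set l) (mem_set (lower_cells_mono jk l)) lt_cell//=.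
    have := rdist_not_cell (y j + h) jk (or_introl l); lra.
  rewrite (memNset nl); have [u|nu] := pselect (lower_cells j.+1 x); last first.
    rewrite (memNset nu) /=.
    have := rdist_not_cell (y j + h) jk (or_intror nu).
    by case: (x <= y j + h) => /=; lra.
  rewrite (mem_set u)/= (rdist_cell jk nl u).
  have := rdist_le x (move_facility j (y j + h)) jk.
  rewrite /move_facility eqxx => /le_trans; apply.
  have tri : `|x - (y j + h)| <= `|x - y j| + h.
    by rewrite opprD addrA (le_trans (ler_normB _ _))// (gtr0_norm h0).
  have nrm := ler_norm (x - y j).
  have [xy|xy] := leP x (y j + h); rewrite /=; first lra.
  by rewrite ger0_norm; lra.
have := Rintegral_rdist_le (mray _) (measurable_lower_cells _)
  (measurable_lower_cells _) le.
have := y_opt (move_facility j (y j + h)).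
rewrite cdfmE -/(G _) -/(G _) => *; rewrite -(ler_pM2l h0); lra.
Qed.

Lemma moved_left_cost j h : (j < k)%N -> 0 < h ->
  2 * (F (y j - h) - G j) <= G j.+1 - G j.
Proof.
move=> jk h0.
(* On the cell the change is [-h] up to [y j - h] and [+h] beyond. Above the cell the ray is not
   met, since [y j] lies below the midpoint. *)
have le x : rdist k x (move_facility j (y j - h)) <= rdist k x y +
    - (2 * h) * \1_([set` `]-oo, y j - h]]) x + h * \1_(lower_cells j.+1) x +
    h * \1_(lower_cells j) x.
  rewrite indic_ray !indicE.
  have [l|nl] := pselect (lower_cells j x).
    rewrite (mem_set l) (mem_set (lower_cells_mono jk l)) /=.
    have := rdist_not_cell (y j - h) jk (or_introl l).
    by case: (x <= y j - h) => /=; lra.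
  rewrite (memNset nl); have [u|nu] := pselect (lower_cells j.+1 x); last first.
    have jk1 : (j.+1 < k)%N.
      by rewrite ltnNge; apply/negP => kj; apply: nu; rewrite lower_cells_full.
    have yj : y j <= y j.+1 by exact: y_sorted.
    have : midpoint j < x.
      by rewrite ltNge; apply/negP => hm; apply: nu; apply/lower_cellsP.
    rewrite /midpoint (memNset nu) /= => xm.
    have -> : (x <= y j - h) = false by apply/negbTE; rewrite -ltNge; lra.
    have := rdist_not_cell (y j - h) jk (or_intror nu); rewrite /=; lra.
  rewrite (mem_set u)/= (rdist_cell jk nl u).
  have := rdist_le x (move_facility j (y j - h)) jk.
  rewrite /move_facility eqxx => /le_trans; apply.
  have tri : `|x - (y j - h)| <= `|x - y j| + h.
    by rewrite opprB addrA addrAC (le_trans (ler_normD _ _))// (gtr0_norm h0).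
  have [xy|xy] := leP x (y j - h); rewrite /=.
    by rewrite !ler0_norm; lra.
  lra.
have := Rintegral_rdist_le (mray _) (measurable_lower_cells _)
  (measurable_lower_cells _) le.
have := y_opt (move_facility j (y j - h)).
rewrite cdfmE -/(G _) -/(G _) => *; rewrite -(ler_pM2l h0); lra.
Qed.

(** The two one-sided inequalities meet as [h] tends to 0; [e / 2] compensates the factor 2 in front
    of [F]. *)
Lemma first_order_condition j : (j < k)%N ->
  (forall e, 0 < e -> exists2 h, 0 < h & F (y j + h) - F (y j - h) <= e) ->
  (forall a b, a <= b -> F a <= F b) ->
  2 * (F (y j) - G j) = G j.+1 - G j.
Proof.
move=> jk Fcont Fmono; apply/eqP; rewrite eq_le; apply/andP; split.
  apply/ler_addgt0Pr => e e0; have [|h h0 hF] := Fcont (e / 2).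
    by rewrite divr_gt0.
  have := moved_left_cost jk h0; have : F (y j) <= F (y j + h) by apply: Fmono; lra.
  lra.
apply/ler_addgt0Pr => e e0; have [|h h0 hF] := Fcont (e / 2).
  by rewrite divr_gt0.
have := moved_right_cost jk h0; have : F (y j - h) <= F (y j) by apply: Fmono; lra.
lra.
Qed.

(* Otherwise the [j]-th facility would be wasted: sending it to [z] would
   strictly lower the cost near [z]. *)
Lemma cell_positive j (z eta : R) : (j < k)%N -> 0 < eta -> 3 * eta <= rdist k z y ->
  (0 < mu [set` `](z - eta)%R, (z + eta)%R[])%E -> G j < G j.+1.
Proof.
move=> jk eta0 zeta mupos; rewrite ltNge; apply/negP => GG.
pose I : set R := [set` `]z - eta, z + eta[].
have mI : measurable I by exact: measurable_itv.
(* Within [eta] of [z] the old cost is at least [2 * eta] and the new one below [eta]. On the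
   abandoned cell the loss is at most [|z - y j|], by the triangle inequality. *)
have le x : rdist k x (move_facility j z) <= rdist k x y +
    - eta * \1_I x + `|z - y j| * \1_(lower_cells j.+1) x +
    - `|z - y j| * \1_(lower_cells j) x.
  have II : \1_I x = (z - eta < x < z + eta)%R%:R :> R.
    by rewrite indicE mem_setE in_itv.
  have [Ix|nIx] := boolP (z - eta < x < z + eta).
    have := rdist_le x (move_facility j z) jk.
    rewrite /move_facility eqxx => /le_trans; apply; rewrite II Ix.
    have xz : `|x - z| < eta by rewrite ltr_norml; lra.
    have := rdist_lipschitz k z x y; rewrite distrC.
    have : `|z - y j| * \1_(lower_cells j) x <=
           `|z - y j| * \1_(lower_cells j.+1) x.
      rewrite ler_wpM2l// !indicE ler_nat.
      have [l|nl] := pselect (lower_cells j x); last by rewrite (memNset nl).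
      by rewrite (mem_set l) (mem_set (lower_cells_mono jk l)).
    rewrite /=; lra.
  rewrite II (negbTE nIx) !indicE /=.
  have [l|nl] := pselect (lower_cells j x).
    rewrite (mem_set l) (mem_set (lower_cells_mono jk l)) /=.
    have := rdist_not_cell z jk (or_introl l); lra.
  rewrite (memNset nl); have [u|nu] := pselect (lower_cells j.+1 x); last first.
    rewrite (memNset nu) /=.
    have := rdist_not_cell z jk (or_intror nu); lra.
  rewrite (mem_set u)/= (rdist_cell jk nl u).
  have := rdist_le x (move_facility j z) jk.
  rewrite /move_facility eqxx => /le_trans; apply.
  have := ler_distD (y j) x z; rewrite (distrC (y j) z); lra.
have := Rintegral_rdist_le mI (measurable_lower_cells _)
  (measurable_lower_cells _) le.
have := y_opt (move_facility j z); rewrite -/(G _) -/(G _).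
have : `|z - y j| * G j.+1 <= `|z - y j| * G j by rewrite ler_wpM2l.
have : 0 < eta * fine (mu I).
  rewrite mulr_gt0// fine_gt0// mupos/=.
  by rewrite (le_lt_trans (probability_le1 mu mI)) ?ltry.
lra.
Qed.

(** Near [z] the distance is at least [eta]. Positivity of the limit cost is what allows passing to
    the ratio in [Bar_PM_cvg1]. *)
Lemma k_median_cost_gt0 (z eta : R) : 0 < eta -> 3 * eta <= rdist k z y ->
  (0 < mu [set` `](z - eta)%R, (z + eta)%R[])%E -> 0 < \int[mu]_x rdist k x y.
Proof.
move=> eta0 zeta mupos; pose I : set R := [set` `]z - eta, z + eta[].
have mI : measurable I by exact: measurable_itv.
have : eta * fine (mu I) <= \int[mu]_x rdist k x y.
  rewrite -(Rintegral_scaled_indic int_norm)//; apply: le_Rintegral => //.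
  - exact: integrable_scaled_indic.
  - exact: integrable_rdist.
  move=> x _; rewrite indicE mem_setE in_itv/=.
  have [Ix|_] := boolP (z - eta < x < z + eta); last by rewrite mulr0 rdist_ge0.
  rewrite mulr1.
  have xz : `|x - z| < eta by rewrite ltr_norml; lra.
  have := rdist_lipschitz k z x y; rewrite distrC; lra.
apply: lt_le_trans; rewrite mulr_gt0// fine_gt0// mupos/=.
by rewrite (le_lt_trans (probability_le1 mu mI)) ?ltry.
Qed.

End first_order.

(** * Laws with a density *)

Section cumulative.
Context {R : realType}.
Variable mu : probability R R.

Lemma cdfm_diff (c d : R) : c <= d ->
  cdfm mu d = cdfm mu c + fine (mu [set` `]c, d]]).
Proof.
move=> cd; rewrite /cdfm.
have E : [set` `]-oo, d]] = [set` `]-oo, c]] `|` [set` `]c, d]] :> set R.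
  by rewrite -itv_bndbnd_setU// bnd_simp.
have H : (mu [set` `]-oo, d]] = mu [set` `]-oo, c]] + mu [set` `]c, d]])%E.
  rewrite E; apply: (@measureU _ _ _ mu); [exact: measurable_itv|exact: measurable_itv|].
  apply/seteqP; split => x //= []; rewrite !in_itv /= => xc /andP[cx _].
  by move: cx; rewrite ltNge xc.
by rewrite H fineD// fin_num_measure//; exact: measurable_itv.
Qed.

Lemma cdfm_nondecreasing (c d : R) : c <= d -> cdfm mu c <= cdfm mu d.
Proof. by move=> cd; rewrite (cdfm_diff cd) lerDl fine_ge0. Qed.

Lemma cdfm_itv01 (x : R) : 0 <= cdfm mu x <= 1.
Proof. by apply: fine_mu_itv01; exact: measurable_itv. Qed.

(** Continuity of [mu] from above along closed intervals shrinking to [x], in the form used by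
    [first_order_condition]. *)
Lemma cdfm_local_variation (x : R) : mu [set x] = 0%E -> forall e : R, 0 < e ->
  exists2 h, 0 < h & cdfm mu (x + h) - cdfm mu (x - h) <= e.
Proof.
move=> mux e e0.
pose nb (n : nat) : set R := [set` `]x - n.+1%:R^-1, x + n.+1%:R^-1]].
have mI n : measurable (nb n) by exact: measurable_itv.
have capI : \bigcap_n nb n = [set x].
  apply/seteqP; split => z /=; last first.
    move=> -> n _; rewrite /nb /= in_itv /=.
    have : 0 < n.+1%:R^-1 :> R by rewrite invr_gt0.
    by move: n.+1%:R^-1 => h h0; lra.
  move=> Iz; apply/eqP; rewrite -subr_eq0 -normr_le0; apply/ler_addgt0Pr => d d0.
  rewrite add0r; have [n _ nd] := @near_inv_small R 1 d ler01 d0.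
  have := Iz n I; rewrite /nb /= in_itv /= => zI.
  have := nd n.+1 (leqnSn n); rewrite /= mul1r ler_norml.
  by move: n.+1%:R^-1 zI => h zI hd; lra.
have cvgI : (mu \o nb) n @[n --> \oo] --> mu (\bigcap_n nb n).
  apply: (@nonincreasing_cvg_mu _ _ _ mu) => //.
  - by rewrite (le_lt_trans (probability_le1 mu (mI 0%N))) ?ltry.
  - by rewrite capI; exact: measurable_set1.
  - move=> m n mn; apply/subsetPset => z; rewrite /nb /= !in_itv /=.
    have : n.+1%:R^-1 <= m.+1%:R^-1 :> R by rewrite lef_pV2 ?posrE// ler_nat.
    by move: n.+1%:R^-1 m.+1%:R^-1 => h h' hh' hz; lra.
have : \forall n \near \oo, ((mu \o nb) n < e%:E)%E.
  apply: (cvgI [set u | (u < e%:E)%E]); apply: open_ereal_lt'.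
  by rewrite capI mux lte_fin.
move=> [N _ /(_ N (leqnn _))] /= muN.
exists N.+1%:R^-1; first by rewrite invr_gt0.
have : 0 < N.+1%:R^-1 :> R by rewrite invr_gt0.
move: muN; rewrite /nb; move: N.+1%:R^-1 => h muh h0.
have -> : cdfm mu (x + h) = cdfm mu (x - h) + fine (mu [set` `]x - h, x + h]]).
  by apply: cdfm_diff; lra.
rewrite addrC addKr -lee_fin fineK ?fin_num_measure//; first exact: ltW.
Qed.

End cumulative.

Lemma ereal_between {R : realType} (a b : \bar R) : (a < b)%E ->
  exists r : R, (a < r%:E < b)%E.
Proof.
case: a b => [a| |] [b| |]//; rewrite ?lte_fin => ab.
- by exists ((a + b) / 2); rewrite !lte_fin; lra.
- by exists (a + 1); rewrite lte_fin ltry andbT ltrDl.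
- by exists (b - 1); rewrite ltNyr lte_fin /= gtrDl oppr_lt0.
- by exists 0; rewrite ltNyr ltry.
Qed.

(** The absence of atoms gives continuity of the c.d.f. and positive mass its strict growth; the
    last two clauses place any point with c.d.f. value in [(0,1)] strictly between [a] and [b]. *)
Lemma standing_assumptions_cdfm {R : realType} (mu : probability R R) :
  standing_assumptions mu -> exists a b : \bar R,
    [/\ (a < b)%E, forall x : R, mu [set x] = 0%E,
        forall c d : R, c < d -> (a < d%:E)%E -> (c%:E < b)%E ->
          (0 < mu [set` `]c, d[])%E,
        forall x : R, (x%:E <= a)%E -> cdfm mu x = 0 &
        forall x : R, (b <= x%:E)%E -> cdfm mu x = 1].
Proof.
move=> [rho [a [b [ab [mrho [rho0 [muE [rho_out [rho_in _]]]]]]]]].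
have mrhoE (D : set R) : measurable_fun D (fun x => (rho x)%:E).
  by apply/measurable_EFinP; exact: measurable_funTS.
exists a, b; split => //.
- by move=> x; rewrite muE ?integral_set1//; exact: measurable_set1.
- move=> c d cd ad cb.
  (* []p, q[] is the part of []c, d[] inside the support, with real endpoints even if [a] or [b] is
     infinite. *)
  have [p [q [pq cp qd inab]]] : exists p q, [/\ p < q, c <= p, q <= d &
      forall x, p < x < q -> (a < x%:E)%E /\ (x%:E < b)%E].
    pose p := if a is a'%:E then Num.max c a' else c.
    pose q := if b is b'%:E then Num.min d b' else d.
    exists p, q; split.
    + rewrite /p /q; move: a b ab ad cb {rho_out rho_in p q} => [a'| |] [b'| |]//;
      rewrite ?lte_fin => *; by rewrite ?lt_min ?gt_max; do ?[apply/andP; split].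
    + by rewrite /p; case: (a) => // ?; rewrite le_max lexx.
    + by rewrite /q; case: (b) => // ?; rewrite ge_min lexx.
    + move=> x /andP[]; rewrite /p /q.
      move: a b ab ad cb {rho_out rho_in p q} => [a'| |] [b'| |]//;
      rewrite ?lte_fin ?ltNyr ?ltry ?gt_max ?lt_min => _ _ _ ? ?; split => //; lra.
  apply: (@lt_le_trans _ _ (mu [set` `]p, q[])); last first.
    apply: (@le_measure _ _ _ mu); rewrite ?inE; [exact: measurable_itv..|].
    by apply: subset_itv; rewrite bnd_simp.
  rewrite lt0e measure_ge0 andbT; apply/eqP; rewrite muE; last exact: measurable_itv.
  (* Were the integral zero, [rho] would vanish almost everywhere on []p, q[]; being positive there,
     it would make an interval of length [q - p] Lebesgue-null. *)
  move=> int0.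
  have mpq := @measurable_itv R `]p, q[.
  have [+ _] := ae_eq_integral_abs lebesgue_measure mpq (mrhoE [set` `]p, q[]).
  move=> /(_ _)[|N [mN N0 subN]].
    by rewrite -[RHS]int0; apply: eq_integral => x _; rewrite gee0_abs// lee_fin.
  have : (lebesgue_measure ([set` `]p, q[] : set R) <= lebesgue_measure N)%E.
    apply: le_measure; rewrite ?inE//.
    move=> x /= xpq; apply: subN => /= /(_ xpq) [rx0].
    have [ax xb] : (a < x%:E)%E /\ (x%:E < b)%E.
      by apply: inab; move: xpq; rewrite in_itv.
    by have := rho_in _ ax xb; rewrite rx0 ltxx.
  by rewrite N0 lebesgue_measure_itv /= lte_fin pq -EFinB lee_fin leNgt subr_gt0 pq.
- move=> x xa; rewrite /cdfm muE; last exact: measurable_itv.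
  rewrite -integral_itv_bndo_bndc// integral0_eq// => t /=; rewrite in_itv /= => tx.
  by rewrite rho_out//; left; rewrite (lt_le_trans _ xa)// lte_fin.
- move=> x bx; have mr := @measurable_itv R `]-oo, x].
  have : mu [set` `]x, +oo[] = 0%E.
    rewrite muE; last exact: measurable_itv.
    rewrite integral0_eq// => t /=; rewrite in_itv /= andbT => xt.
    by rewrite rho_out//; right; rewrite (le_lt_trans bx)// lte_fin.
  have -> : [set` `]x, +oo[] = ~` [set` `]-oo, x]] :> set R by rewrite setCitvl.
  rewrite (probability_setC mu mr) /cdfm.
  rewrite -[mu _]fineK ?fin_num_measure// -EFinB => -[].
  by move=> /eqP; rewrite subr_eq0 => /eqP <-.
Qed.

(** * First-order system and optimality of the percentiles *)

Theorem theorem6 (R : realType) (k : nat) (mu : probability R R)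
  (w y : nat -> R) :
  (2 <= k)%N ->
  standing_assumptions mu ->
  (\int[mu]_x (`|x|)%:E < +oo)%E ->
  (* nu = sum_j w_j delta_{y_j} in P_k(R), support points y_0 <= ... <= y_{k-1} *)
  (forall j, (j < k)%N -> 0 < w j) ->
  \sum_(j < k) w j = 1 ->
  (forall i j, (i <= j)%N -> (j < k)%N -> y i <= y j) ->
  (* nu minimizes W1(mu, .) over P_k(R) *)
  (forall w' x' : nat -> R, Pk_weights k w' ->
     (W1 mu (discr k w y) <= W1 mu (discr k w' x'))%E) ->
  let F := cdfm mu in
  let m := fun j => (y j + y j.+1) / 2 in
  (forall j, (j < k)%N -> 0 < F (y j) < 1) /\
  optimal_percentile_vector k mu (fun j => F (y j)) /\
  2 * F (y 0%N) = F (m 0%N) /\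
  (forall j, (1 <= j)%N -> (j < k.-1)%N ->
     2 * (F (y j) - F (m j.-1)) = F (m j) - F (m j.-1)) /\
  2 * (F (y k.-1) - F (m k.-2)) = 1 - F (m k.-2).
Proof.
case: k => [//|[//|k]] _ /standing_assumptions_cdfm[a [b [ab atom pos Fa Fb]]].
move=> int_norm _ _ y_sorted W1_opt F m.
have y_opt := W1_minimizer_k_median int_norm (ltn0Sn _) W1_opt.
(* A ball of positive mass away from all facilities: an interval inside the support cannot be
   covered by finitely many points, since those are Lebesgue-null. *)
have [z [eta [eta0 zeta ballpos]]] : exists z eta : R, [/\ 0 < eta,
    3 * eta <= rdist k.+2 z y & (0 < mu [set` `](z - eta)%R, (z + eta)%R[])%E].
  have [p /andP[ap pb]] := ereal_between ab.
  have [q /andP[pq qb]] := ereal_between pb.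
  have [z zpq zy] : exists2 z, p < z < q & rdist k.+2 z y != 0.
    apply: contrapT => nz.
    have sub : [set` `]p, q[] `<=` y @` `I_k.+2.
      move=> z /=; rewrite in_itv /= => zpq.
      have [//|j jk E] := @rdist_attained _ k.+2 z y; exists j => //.
      apply/esym/eqP; rewrite -subr_eq0 -normr_eq0 -E; apply/negP => zy.
      by apply: nz; exists z => //; exact/negP.
    have := countable_lebesgue_measure0 (finite_set_countable
      (sub_finite_set sub (finite_image y (finite_II k.+2)))).
    rewrite lebesgue_measure_itv /= pq -EFinB => -[]/eqP.
    by rewrite subr_eq0; move: pq; rewrite lte_fin => /gt_eqF ->.
  have /andP[pz zq] := zpq.
  have dz : 0 < rdist k.+2 z y by rewrite lt_def zy rdist_ge0.
  exists z, (rdist k.+2 z y / 3); split; first by rewrite divr_gt0.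
    by rewrite mulrC divfK.
  apply: pos.
  - lra.
  - by rewrite (lt_trans ap)// lte_fin; lra.
  - by rewrite (lt_trans _ qb)// lte_fin; lra.
(* With the boundary values 0 and 1 of [G], the three shapes of equation in the system are instances
   of the one identity [foc]. *)
pose G j := fine (mu (lower_cells k.+2 y j)).
have G0 : G 0%N = 0 by rewrite /G /= measure0.
have GF j : (j < k.+1)%N -> G j.+1 = F (m j).
  by move=> jk; rewrite /G /lower_cells ltnS jk.
have Gk : G k.+2 = 1 by rewrite /G /= ltnn probability_realT.
have Gpos j : (j < k.+2)%N -> G j < G j.+1.
  by move=> jk; exact: (cell_positive int_norm y_sorted y_opt jk eta0 zeta ballpos).
have foc j : (j < k.+2)%N -> 2 * (F (y j) - G j) = G j.+1 - G j.
  move=> jk; apply: first_order_condition => //.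
    exact: cdfm_local_variation (atom _).
  exact: cdfm_nondecreasing.
have Fmono i j : (i <= j)%N -> (j < k.+2)%N -> F (y i) <= F (y j).
  by move=> ij jk; apply: cdfm_nondecreasing; exact: y_sorted.
(* By [foc], [F] at the first point is half the mass of the first cell, and [1 - F] at the last
   point is half that of the last cell; both are positive by [Gpos]. *)
have F01 j : (j < k.+2)%N -> 0 < F (y j) < 1.
  move=> jk; apply/andP; split.
    apply: lt_le_trans (Fmono _ _ (leq0n j) jk).
    by have := foc 0%N isT; have := Gpos 0%N isT; rewrite G0; lra.
  apply: le_lt_trans (Fmono _ k.+1 _ (ltnSn _)) _; first by rewrite -ltnS.
  by have := foc k.+1 (ltnSn _); have := Gpos k.+1 (ltnSn _); rewrite Gk; lra.
split; [exact: F01|split; [|split; [|split]]].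
- split.
    split; last exact: Fmono.
    by move=> j _; exact: cdfm_itv01.
  apply: (@Bar_PM_cvg1 _ _ int_norm _ _ y) => //; last first.
    exact: (k_median_cost_gt0 int_norm eta0 zeta ballpos).
  move=> j ep jk ep0; have /andP[Fj0 Fj1] := F01 _ jk.
  have aj : (a < (y j)%:E)%E.
    by rewrite ltNge; apply/negP => /Fa Fj; move: Fj0; rewrite /F Fj ltxx.
  have bj : ((y j)%:E < b)%E.
    by rewrite ltNge; apply/negP => /Fb Fj; move: Fj1; rewrite /F Fj ltxx.
  (* Strict growth around [y j] separates its percentile from the values of [F] at [y j - ep] and
     [y j + ep]. *)
  have strict (c d : R) : c < d -> (a < d%:E)%E -> (c%:E < b)%E -> F c < F d.
    move=> cd ad cb; rewrite /F (cdfm_diff mu (ltW cd)) ltrDl fine_gt0//.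
    rewrite (lt_le_trans (pos _ _ cd ad cb))/=; last first.
      apply: (@le_measure _ _ _ mu); rewrite ?inE; [exact: measurable_itv..|].
      by apply: subset_itv; rewrite bnd_simp.
    by rewrite (le_lt_trans (probability_le1 mu (measurable_itv _))) ?ltry.
  apply/andP; split; apply: strict => //; rewrite ?gtrDl ?ltrDl ?oppr_lt0//.
    by rewrite (lt_trans _ bj)// lte_fin gtrDl oppr_lt0.
  by rewrite (lt_trans aj)// lte_fin ltrDl.
- by have := foc 0%N isT; rewrite G0 GF// !subr0.
- move=> j j1 jk /=; have := foc j (leqW jk).
  by rewrite GF// -[in G j](prednK j1) GF// prednK// ltnW.
- by have := foc k.+1 (ltnSn _); rewrite Gk GF.
Qed.
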